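(* Let $d\geq 3$. If $P\subset\mathbb{R}^d$ is a finite set determining exactly two distinct triangles, then $|P|\leq 2d$. Moreover, a set $P\subset\mathbb{R}^d$ with $|P|=2d$ determines exactly two distinct triangles if and only if $P$ is the vertex set of a regular $d$-orthoplex, i.e. $P$ is the image of $\{\pm e_1,\dots,\pm e_d\}$ (with $e_1,\dots,e_d$ the standard basis of $\mathbb{R}^d$) under a similarity of $\mathbb{R}^d$.
   Context: For a finite set $P\subset\mathbb{R}^d$, a triangle determined by $P$ is a set $\{a,b,c\}\subseteq P$ of three non-collinear points. Two such triangles are considered the same (congruent) if some isometry of $\mathbb{R}^d$ maps one vertex set onto the other, equivalently if they have the same multiset of side lengths. ''The number of distinct triangles determined by $P$'' means the number of congruence classes of triangles determined by $P$. *)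

(* Defs.v *)
From HB Require Import structures.
From mathcomp Require Import all_boot all_order all_algebra.
From mathcomp Require Import finmap.
From mathcomp Require Import boolp reals.

Set Implicit Arguments.
Unset Strict Implicit.
Unset Printing Implicit Defensive.

Import Order.TTheory GRing.Theory Num.Theory.

Local Open Scope fset_scope.
Local Open Scope ring_scope.

Section Definitions.
Variables (R : realType) (d : nat).
Implicit Types (x y : 'rV[R]_d) (S T P : {fset 'rV[R]_d}).

(* The norm that MathComp-Analysis puts on 'rV[R]_d is the sup norm, hence
   this explicit Euclidean distance. *)
Definition edist x y : R := Num.sqrt (\sum_(i < d) (x 0 i - y 0 i) ^+ 2).

Definition is_isometry (f : 'rV[R]_d -> 'rV[R]_d) : Prop :=
  forall x y, edist (f x) (f y) = edist x y.

Definition is_similarity (f : 'rV[R]_d -> 'rV[R]_d) : Prop :=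
  exists2 r : R, 0 < r & forall x y, edist (f x) (f y) = r * edist x y.

Definition collinear T : Prop :=
  exists p v : 'rV[R]_d, forall x, x \in T -> exists t : R, x = p + t *: v.

Definition congruent S T : Prop :=
  exists2 f : 'rV[R]_d -> 'rV[R]_d, is_isometry f & [fset f x | x in S] = T.

Definition triangles P : {fset {fset 'rV[R]_d}} :=
  [fset T in fpowerset P | (#|` T| == 3)%N && ~~ `[< collinear T >]].

Definition triangle_classes P : {fset {fset {fset 'rV[R]_d}}} :=
  [fset [fset T in triangles P | `[< congruent S T >]] | S in triangles P].

Definition num_triangles P : nat := #|` triangle_classes P|.

Definition std_orthoplex : {fset 'rV[R]_d} :=
  [fset delta_mx 0 i | i in 'I_d] `|` [fset - delta_mx 0 i | i in 'I_d].

Definition regular_orthoplex P : Prop :=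
  exists2 f : 'rV[R]_d -> 'rV[R]_d,
    is_similarity f & P = [fset f x | x in std_orthoplex].

End Definitions.

(* Main.v *)
(* A finite set with at least 2d >= 6 points and at most two triangle types
   (multisets of side lengths) contains no three collinear points: Heron's
   formula makes the middle one a midpoint and forces all other points onto a
   sphere around it in the orthogonal hyperplane, where two non-antipodal points
   produce a third type. Now every triple of points carries one of two types. A
   triangle with three different sides is impossible for five points, and two
   applications of R(3,3) = 6 give an equilateral triangle of some side p. Hence
   either being equal or at distance p is an equivalence relation with two
   classes, or the distances different from p all equal some v and form a
   matching. The quadratic form sum_ij c_i c_j |x_i - x_j|^2, which vanishes on
   affine dependencies, bounds the number of points by d + 2 < 2d unless
   v^2 = 2 p^2; in that case all points lie on a sphere, matched pairs are
   antipodal and the other pairs are orthogonal. In the lemmas below p and v are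
   squared distances. *)
Require Import Defs.
From mathcomp Require Import all_boot all_order all_algebra.
From mathcomp Require Import finmap ring lra.
From mathcomp Require Import boolp reals.

Set Implicit Arguments.
Unset Strict Implicit.
Unset Printing Implicit Defensive.
Import Order.TTheory GRing.Theory Num.Theory.
Local Open Scope fset_scope.
Local Open Scope ring_scope.

(** * Squared distances, collinearity and congruence *)

Section Dot.
Variables (R : realType) (d : nat).
Implicit Types u v w x y z : 'rV[R]_d.

Definition dot u v : R := \sum_(i < d) u 0 i * v 0 i.

Lemma dotC u v : dot u v = dot v u.
Proof. by apply: eq_bigr => i _; rewrite mulrC. Qed.

Lemma dotDl u v w : dot (u + v) w = dot u w + dot v w.
Proof. by rewrite -big_split; apply: eq_bigr => i _; rewrite mxE mulrDl. Qed.

Lemma dotZl (a : R) u v : dot (a *: u) v = a * dot u v.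
Proof. by rewrite big_distrr; apply: eq_bigr => i _; rewrite mxE -mulrA. Qed.

Lemma dotNl u v : dot (- u) v = - dot u v.
Proof. by rewrite -scaleN1r dotZl mulN1r. Qed.

Lemma dot0l u : dot 0 u = 0.
Proof. by rewrite -(scale0r u) dotZl mul0r. Qed.

Lemma dotDr u v w : dot w (u + v) = dot w u + dot w v.
Proof. by rewrite !(dotC w) dotDl. Qed.

Lemma dotZr (a : R) u v : dot v (a *: u) = a * dot v u.
Proof. by rewrite !(dotC v) dotZl. Qed.

Lemma dotNr u v : dot v (- u) = - dot v u.
Proof. by rewrite !(dotC v) dotNl. Qed.

Definition dotE := (dotDl, dotDr, dotNl, dotNr, dotZl, dotZr).

Lemma dot_suml (I : finType) (F : I -> 'rV[R]_d) v :
  dot (\sum_i F i) v = \sum_i dot (F i) v.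
Proof.
exact: (big_morph (dot^~ v) (fun x y => dotDl x y v) (dot0l v)).
Qed.

Lemma dot_sumr (I : finType) (F : I -> 'rV[R]_d) v :
  dot v (\sum_i F i) = \sum_i dot v (F i).
Proof. by rewrite dotC dot_suml; apply: eq_bigr => i _; rewrite dotC. Qed.

Lemma dot_ge0 u : 0 <= dot u u.
Proof. by apply: sumr_ge0 => i _; rewrite -expr2 sqr_ge0. Qed.

Lemma dot_eq0 u : dot u u = 0 -> u = 0.
Proof.
move=> /eqP; rewrite psumr_eq0 => [/allP u0|i _]; last by rewrite -expr2 sqr_ge0.
apply/rowP => i; rewrite mxE; apply/eqP.
by have := u0 i (mem_index_enum i); rewrite -expr2 sqrf_eq0.
Qed.

Definition sqd x y : R := dot (x - y) (x - y).

Lemma sqdE x y : sqd x y = dot x x + dot y y - 2 * dot x y.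
Proof. by rewrite /sqd !dotE (dotC y x); ring. Qed.

Lemma sqdC x y : sqd x y = sqd y x.
Proof. by rewrite !sqdE (dotC y x); ring. Qed.

Lemma sqd_ge0 x y : 0 <= sqd x y.
Proof. exact: dot_ge0. Qed.

Lemma sqdxx x : sqd x x = 0.
Proof. by rewrite sqdE; ring. Qed.

Lemma sqd_eq0 x y : sqd x y = 0 -> x = y.
Proof. by move/dot_eq0/eqP; rewrite subr_eq0 => /eqP. Qed.

Lemma sqd_gt0 x y : x <> y -> 0 < sqd x y.
Proof.
by move=> xy; rewrite lt_def sqd_ge0 andbT; apply/eqP => /sqd_eq0.
Qed.

Lemma edistE x y : edist x y = Num.sqrt (sqd x y).
Proof.
by congr Num.sqrt; apply: eq_bigr => i _; rewrite !mxE expr2.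
Qed.

Lemma sqr_edist x y : edist x y ^+ 2 = sqd x y.
Proof. by rewrite edistE sqr_sqrtr ?sqd_ge0. Qed.

Lemma isometryP (f : 'rV[R]_d -> 'rV[R]_d) :
  is_isometry f <-> forall x y, sqd (f x) (f y) = sqd x y.
Proof.
split=> H x y; first by rewrite -!sqr_edist H.
by rewrite !edistE H.
Qed.

(** By Heron's formula this is sixteen times the squared area of a triangle with squared sides [a],
    [b], [c]. *)
Definition heron (a b c : R) : R :=
  2 * (a * b + b * c + c * a) - a ^+ 2 - b ^+ 2 - c ^+ 2.

Definition heron3 x y z := heron (sqd x y) (sqd y z) (sqd z x).

(** The right side is four times the Gram determinant of the edge vectors at [x], so the two lemmas
    that follow are Cauchy-Schwarz and its equality case. *)
Lemma heron3E x y z : heron3 x y z =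
  4 * (dot (y - x) (y - x) * dot (z - x) (z - x) - dot (y - x) (z - x) ^+ 2).
Proof.
rewrite /heron3 /heron !sqdE !dotE ?(dotC y x) ?(dotC z x) ?(dotC z y); ring.
Qed.

Lemma heron3_ge0 x y z : 0 <= heron3 x y z.
Proof.
rewrite heron3E; move: (y - x) (z - x) => u v.
have [u0|u0] := eqVneq (dot u u) 0.
  by rewrite (dot_eq0 u0) !dot0l; lra.
have up : 0 < dot u u by rewrite lt_def u0 dot_ge0.
(* The squared length of the part of [v] orthogonal to [u] is the Gram determinant divided by
   [dot u u]. *)
have := dot_ge0 (v - (dot u v / dot u u) *: u).
rewrite !dotE (dotC v u) => H.
have : 0 <= (dot u u * dot v v - dot u v ^+ 2) / dot u u.
  apply: le_trans H _; rewrite le_eqVlt; apply/orP; left; apply/eqP; field => //.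
by rewrite pmulr_lge0 ?invr_gt0 // => ?; lra.
Qed.

Lemma heron3_eq0 x y z : x <> y -> heron3 x y z = 0 ->
  exists t, z = x + t *: (y - x).
Proof.
move=> xy; rewrite heron3E; move Eu : (y - x) => u; move Ev : (z - x) => v H.
have up : dot u u != 0.
  by apply/eqP => /dot_eq0 /eqP; rewrite -Eu subr_eq0 => /eqP/esym.
exists (dot u v / dot u u).
suff /dot_eq0/eqP : dot (v - (dot u v / dot u u) *: u) (v - (dot u v / dot u u) *: u) = 0.
  by rewrite subr_eq0 => /eqP <-; rewrite -Ev addrC subrK.
rewrite !dotE (dotC v u).
transitivity ((dot u u * dot v v - dot u v ^+ 2) / dot u u); first by field.
by rewrite (_ : _ - _ = 0) ?mul0r //; lra.
Qed.

Lemma heron3_line (p v : 'rV[R]_d) (a b c : R) :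
  heron3 (p + a *: v) (p + b *: v) (p + c *: v) = 0.
Proof.
rewrite heron3E.
have E (s t : R) : p + s *: v - (p + t *: v) = (s - t) *: v.
  by rewrite opprD addrACA subrr add0r scalerBl.
rewrite !E !dotE; ring.
Qed.

Lemma collinear3P x y z : x <> y ->
  collinear [fset x; y; z] <-> heron3 x y z = 0.
Proof.
move=> xy; split=> [[p [v H]]|/(heron3_eq0 xy)[t ->]].
  have [|a ->] := H x; first by rewrite !inE eqxx.
  have [|b ->] := H y; first by rewrite !inE eqxx orbT.
  have [|c ->] := H z; first by rewrite !inE eqxx !orbT.
  exact: heron3_line.
exists x, (y - x) => w; rewrite !inE -orbA => /or3P[]/eqP->.
- by exists 0; rewrite scale0r addr0.
- by exists 1; rewrite scale1r addrC subrK.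
- by exists t.
Qed.

(** Reflection in the perpendicular bisector of [x] and [y]; written with distances, it visibly
    fixes every point equidistant from both. *)
Definition reflection x y z : 'rV[R]_d :=
  z - ((sqd z x - sqd z y) / sqd x y) *: (y - x).

Lemma reflection_isom x y : x <> y -> is_isometry (reflection x y).
Proof.
move=> xy; apply/isometryP => z w; rewrite /reflection.
have := lt0r_neq0 (sqd_gt0 xy); rewrite !sqdE !dotE.
rewrite ?(dotC y x) ?(dotC w z) ?(dotC z x) ?(dotC z y) ?(dotC w x) ?(dotC w y).
by move=> ?; field.
Qed.

Lemma reflection_l x y : x <> y -> reflection x y x = y.
Proof.
move=> xy; rewrite /reflection sqdxx sub0r mulNr divff ?lt0r_neq0 ?sqd_gt0 //.
by rewrite scaleN1r opprK addrC subrK.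
Qed.

Lemma reflection_fix x y z : sqd z x = sqd z y -> reflection x y z = z.
Proof. by move=> E; rewrite /reflection E subrr mul0r scale0r subr0. Qed.

Lemma isometry_move x y : exists f : 'rV[R]_d -> 'rV[R]_d,
  [/\ is_isometry f, f x = y & forall z, sqd z x = sqd z y -> f z = z].
Proof.
have [->|/eqP xy] := eqVneq x y; first by exists id.
exists (reflection x y); split; [exact: reflection_isom|exact: reflection_l|].
exact: reflection_fix.
Qed.

(* The three vertices are moved into place one after the other by reflections
   in perpendicular bisectors, which fix the vertices already placed. *)
Lemma congruent_sss a b c a' b' c' :
  sqd a b = sqd a' b' -> sqd b c = sqd b' c' -> sqd c a = sqd c' a' ->
  congruent [fset a; b; c] [fset a'; b'; c'].
Proof.
move=> ab bc ca.
have [f [/isometryP fI fa _]] := isometry_move a a'.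
have [g [/isometryP gI gb gfix]] := isometry_move (f b) b'.
have ga : g a' = a' by apply: gfix; rewrite -{1}fa fI ab.
have [h [/isometryP hI hc hfix]] := isometry_move (g (f c)) c'.
have ha : h a' = a'.
  by apply: hfix; rewrite -{1}ga -{1}fa gI fI sqdC ca sqdC.
have hb : h b' = b' by apply: hfix; rewrite -{1}gb gI fI.
exists (h \o g \o f).
  by apply/isometryP => x y /=; rewrite hI gI fI.
apply/fsetP => x; apply/imfsetP/idP => /= [[y]|].
  by rewrite !inE -orbA => /or3P[]/eqP-> ->;
    rewrite ?fa ?gb ?ga ?hb ?ha ?hc eqxx ?orbT.
rewrite !inE -orbA => /or3P[]/eqP->.
- by exists a; rewrite ?inE ?eqxx //= fa ga ha.
- by exists b; rewrite ?inE ?eqxx ?orbT //= gb hb.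
- by exists c; rewrite ?inE ?eqxx ?orbT //= hc.
Qed.

(** Equality of multisets, spelled out as six permutations so that case analysis and [congruence]
    settle questions about side lengths. *)
Definition perm3 (T : Type) (a b c x y z : T) : Prop :=
  [/\ a = x, b = y & c = z] \/ [/\ a = x, b = z & c = y] \/
  [/\ a = y, b = x & c = z] \/ [/\ a = y, b = z & c = x] \/
  [/\ a = z, b = x & c = y] \/ [/\ a = z, b = y & c = x].

(** An isometry is injective, so of the 27 placements of the images of the vertices only the six
    bijective ones remain, and each permutes the sides. *)
Lemma congruent_perm3 a b c a' b' c' : a <> b -> b <> c -> c <> a ->
  congruent [fset a; b; c] [fset a'; b'; c'] ->
  perm3 (sqd a b) (sqd b c) (sqd c a) (sqd a' b') (sqd b' c') (sqd c' a').
Proof.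
move=> ab bc ca [f /isometryP fI fS].
have inj x y : x <> y -> f x <> f y.
  by move=> xy e; apply/xy/sqd_eq0; rewrite -fI e sqdxx.
have mem x : x \in [fset a; b; c] -> [\/ f x = a', f x = b' | f x = c'].
  move=> xS; have : f x \in [fset a'; b'; c'] by rewrite -fS; apply/imfsetP; exists x.
  by rewrite !inE -orbA => /or3P[]/eqP->; [constructor 1|constructor 2|constructor 3].
have {}ab := inj _ _ ab; have {}bc := inj _ _ bc; have {}ca := inj _ _ ca.
rewrite -!(fI a) -!(fI b) -!(fI c) /perm3 ?(sqdC b' a') ?(sqdC c' b') ?(sqdC c' a').
have [Ea|Ea|Ea] : [\/ f a = a', f a = b' | f a = c'] by apply: mem; rewrite !inE eqxx.
all: have [Eb|Eb|Eb] : [\/ f b = a', f b = b' | f b = c']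
  by apply: mem; rewrite !inE eqxx orbT.
all: have [Ec|Ec|Ec] : [\/ f c = a', f c = b' | f c = c']
  by apply: mem; rewrite !inE eqxx !orbT.
all: rewrite ?Ea ?Eb ?Ec // in ab bc ca *;
  rewrite ?(sqdC b' a') ?(sqdC c' b') ?(sqdC c' a');
  do 5?[by left | right]; by [].
Qed.
End Dot.

(** * Colourings with two triangle types *)

Lemma perm3_sym (T : Type) (a b c x y z : T) :
  perm3 a b c x y z -> perm3 x y z a b c.
Proof.
by case=> [|[|[|[|[|]]]]] [-> -> ->]; do 5?[by left | right].
Qed.

Lemma perm3_trans (T : Type) (a b c x y z u v w : T) :
  perm3 a b c x y z -> perm3 x y z u v w -> perm3 a b c u v w.
Proof.
by case=> [|[|[|[|[|]]]]] [-> -> ->];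
  case=> [|[|[|[|[|]]]]] [-> -> ->]; do 5?[by left | right].
Qed.

Lemma perm3_rot (T : Type) (a b c : T) : perm3 a b c b c a.
Proof. by do 5?[by left | right]. Qed.

Lemma perm3_rotr (T : Type) (a b c : T) : perm3 a b c c a b.
Proof. by do 5?[by left | right]. Qed.

Lemma exists_notin (T : finType) (s : seq T) :
  (size s < #|T|)%N -> exists t, t \notin s.
Proof.
move=> lt_s; apply/existsP; apply: contraLR lt_s.
rewrite negb_exists -leqNgt cardT => /forallP H.
by apply: uniq_leq_size (enum_uniq _) _ => t _; have := H t; rewrite negbK.
Qed.

(** The bound R(3,3) = 6. One of the two colours joins [x] to at least three vertices, and [step]
    finds a triangle through [x] or among these three. *)
Lemma ramsey33 (T : finType) (e : rel T) : symmetric e -> (6 <= #|T|)%N ->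
  exists x y z, [/\ x != y, y != z & z != x] /\
    ([/\ e x y, e y z & e z x] \/ [/\ ~~ e x y, ~~ e y z & ~~ e z x]).
Proof.
move=> eC T6; have [x _] : exists x : T, x \notin [::].
  by apply: exists_notin; apply: leq_trans T6.
have step (f : rel T) : symmetric f -> (2 < #|[set y | (y != x) && f x y]|)%N ->
  exists x y z, [/\ x != y, y != z & z != x] /\
    ([/\ f x y, f y z & f z x] \/ [/\ ~~ f x y, ~~ f y z & ~~ f z x]).
  move=> fC /card_gt2P[a [b [c [[]]]]]; rewrite !inE.
  move=> /andP[ax fa] /andP[bx fb] /andP[cx fc] [ab bc ca].
  case fab: (f a b).
    exists x, a, b; rewrite eq_sym ax ab bx fa fab fC fb; split=> //; by left.
  case fbc: (f b c).
    exists x, b, c; rewrite eq_sym bx bc cx fb fbc fC fc; split=> //; by left.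
  case fca: (f c a).
    exists x, c, a; rewrite eq_sym cx ca ax fc fca fC fa; split=> //; by left.
  exists a, b, c; rewrite ab bc ca fab fbc fca; split=> //; by right.
have [|le2] := ltnP 2 #|[set y | (y != x) && e x y]|; first exact: step.
have B3 : (2 < #|[set y | (y != x) && ~~ e x y]|)%N.
  set A := [set y | (y != x) && e x y] in le2; set B := [set y | _].
  have : (#|[set~ x]| <= #|A| + #|B|)%N.
    rewrite (leq_trans _ (leq_card_setU A B)) // subset_leq_card //.
    by apply/subsetP => y; rewrite !inE; case: (e x y) => ->.
  rewrite cardsC1 => H.
  have : (5 <= 2 + #|B|)%N.
    apply: leq_trans (leq_add le2 (leqnn _)); apply: leq_trans H.
    by case: #|T| T6.
  by rewrite -[5%N]/(2 + 3)%N leq_add2l.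
have neC : symmetric (fun a b => ~~ e a b) by move=> a b; rewrite eC.
have [x' [y [z [dist H]]]] := step _ neC B3.
by exists x', y, z; split=> //; case: H => -[]; rewrite ?negbK; [right|left].
Qed.

Section Coloring.
Variables (R : realType) (T : finType) (D : T -> T -> R).
Hypothesis DC : forall x y, D x y = D y x.

Definition all_triples (Q : R -> R -> R -> Prop) := forall x y z : T,
  x != y -> y != z -> z != x -> Q (D x y) (D y z) (D z x).

(* Every triangle on the edge [xy] has the type of [xyz], so two of any three
   apexes see [x] and [y] at the same distances. *)
Lemma no_rainbow_edge x2 y2 z2 x y z : (5 <= #|T|)%N ->
  x != y -> y != z -> z != x ->
  D x y <> D y z -> D y z <> D z x -> D z x <> D x y ->
  all_triples (fun a b c => perm3 a b c (D x y) (D y z) (D z x) \/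
                            perm3 a b c x2 y2 z2) ->
  (forall w, w != x -> w != y ->
     perm3 (D x y) (D y w) (D w x) (D x y) (D y z) (D z x)) -> False.
Proof.
move=> T5 xy yz zx; set c := D x y; set a := D y z; set b := D z x.
move=> ca ab bc types edge.
(* The triangles [x w w'] and [y w w'] are isosceles, hence both of the second type; but they share
   the side [w w'], and the legs are [a] in one and [b] in the other. *)
have same w w' : w != w' -> w != x -> w != y -> w' != x -> w' != y ->
    D w x = D w' x -> D y w = D y w' ->
    (D y w = a /\ D w x = b) \/ (D y w = b /\ D w x = a) -> False.
  move=> ww wx wy wx' wy' e1 e2 e3.
  have := types x w w'; rewrite eq_sym => /(_ wx ww wx') t1.
  have := types y w w'; rewrite eq_sym => /(_ wy ww wy') t2.
  have {}t1 : perm3 (D x w) (D w w') (D w' x) x2 y2 z2.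
    case: t1 => //; rewrite -e1 (DC x w) -/a -/b -/c.
    by case=> [|[|[|[|[|]]]]] []; case: e3 => -[] *; congruence.
  have {}t2 : perm3 (D y w) (D w w') (D w' y) x2 y2 z2.
    case: t2 => //; rewrite (DC w' y) -e2 -/a -/b -/c.
    by case=> [|[|[|[|[|]]]]] []; case: e3 => -[] *; congruence.
  have := perm3_trans t1 (perm3_sym t2); rewrite (DC x w) -e1 (DC w' y) -e2.
  by case=> [|[|[|[|[|]]]]] []; case: e3 => -[] *; congruence.
have pat w : w != x -> w != y ->
    (D y w = a /\ D w x = b) \/ (D y w = b /\ D w x = a).
  move=> wx wy; have := edge w wx wy; rewrite -/c.
  by case=> [|[|[|[|[|]]]]] [] *; first [by left | by right | congruence].
have [w1] : exists w, w \notin [:: x; y; z] by exact: exists_notin (leq_trans _ T5).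
rewrite !inE !negb_or => /and3P[w1x w1y w1z].
have [w2] : exists w, w \notin [:: x; y; z; w1] by exact: exists_notin (leq_trans _ T5).
rewrite !inE !negb_or => /and4P[w2x w2y w2z w2w].
have zy : z != y by rewrite eq_sym.
have pz : (D y z = a /\ D z x = b) \/ (D y z = b /\ D z x = a) by left.
have [[p1 q1]|[p1 q1]] := pat w1 w1x w1y.
  by apply: (same z w1) => //; rewrite 1?eq_sym.
have [[p2 q2]|[p2 q2]] := pat w2 w2x w2y.
  by apply: (same z w2) => //; rewrite 1?eq_sym.
apply: (same w1 w2) => //; rewrite ?q1 ?p1 ?p2 ?q2 //; last by right.
by rewrite eq_sym.
Qed.

(** If a side of the rainbow triangle is absent from the second type, all triangles on that edge are
    rainbow, which [no_rainbow_edge] excludes. If no side is absent, the three distinct values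
    exhaust the second type, so both types agree. *)
Lemma no_rainbow1 x2 y2 z2 x y z : (5 <= #|T|)%N ->
  x != y -> y != z -> z != x ->
  D x y <> D y z -> D y z <> D z x -> D z x <> D x y ->
  all_triples (fun a b c => perm3 a b c (D x y) (D y z) (D z x) \/
                            perm3 a b c x2 y2 z2) -> False.
Proof.
move=> T5 xy yz zx ca ab bc types.
pose mem c := [\/ c = x2, c = y2 | c = z2].
have [cin|cout] := pselect (mem (D x y)); last first.
  apply: (@no_rainbow_edge x2 y2 z2 x y z) => // w wx wy.
  case: (types x y w) => //; [by rewrite eq_sym|].
  by move=> s2; exfalso; apply: cout; case: s2 => [|[|[|[|[|]]]]] [-> _ _];
    [constructor 1|constructor 1|constructor 2|constructor 2|constructor 3|constructor 3].
have [ain|aout] := pselect (mem (D y z)); last first.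
  apply: (@no_rainbow_edge x2 y2 z2 y z x) => // [i j k ij jk ki|w wx wy].
    case: (types i j k) => // t1; [left|by right].
    exact: perm3_trans t1 (perm3_rot _ _ _).
  case: (types y z w) => //; [by rewrite eq_sym| |].
    by move=> t1; apply: perm3_trans t1 (perm3_rot _ _ _).
  by move=> s2; exfalso; apply: aout; case: s2 => [|[|[|[|[|]]]]] [-> _ _];
    [constructor 1|constructor 1|constructor 2|constructor 2|constructor 3|constructor 3].
have [bin|bout] := pselect (mem (D z x)); last first.
  apply: (@no_rainbow_edge x2 y2 z2 z x y) => // [i j k ij jk ki|w wx wy].
    case: (types i j k) => // t1; [left|by right].
    exact: perm3_trans t1 (perm3_rotr _ _ _).
  case: (types z x w) => //; [by rewrite eq_sym| |].
    by move=> t1; apply: perm3_trans t1 (perm3_rotr _ _ _).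
  by move=> s2; exfalso; apply: bout; case: s2 => [|[|[|[|[|]]]]] [-> _ _];
    [constructor 1|constructor 1|constructor 2|constructor 2|constructor 3|constructor 3].
have s12 : perm3 x2 y2 z2 (D x y) (D y z) (D z x).
  apply: perm3_sym; move: cin ain bin; rewrite /perm3 /mem.
  by do 3!case=> ?; solve [exfalso; congruence | do 5?[by left | right]; by []].
apply: (@no_rainbow_edge x2 y2 z2 x y z) => // w wx wy.
by case: (types x y w) => // [|t2]; [rewrite eq_sym|exact: perm3_trans t2 s12].
Qed.

Variables x1 y1 z1 x2 y2 z2 : R.
Hypothesis T6 : (6 <= #|T|)%N.
Hypothesis two_types :
  all_triples (fun a b c => perm3 a b c x1 y1 z1 \/ perm3 a b c x2 y2 z2).

Lemma no_rainbow : all_triples (fun a b c => [\/ a = b, b = c | c = a]).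
Proof.
move=> x y z xy yz zx.
apply: contrapT => H.
have T5 : (5 <= #|T|)%N by apply: leq_trans T6.
have [n1 n2 n3] : [/\ D x y <> D y z, D y z <> D z x & D z x <> D x y].
  by split=> e; apply: H; [constructor 1|constructor 2|constructor 3].
have [t|t] := two_types xy yz zx.
  apply: (@no_rainbow1 x2 y2 z2 x y z) => // i j k ij jk ki.
  have [t'|] := two_types ij jk ki; [left|by right].
  exact: perm3_trans t' (perm3_sym t).
apply: (@no_rainbow1 x1 y1 z1 x y z) => // i j k ij jk ki.
have [|t'] := two_types ij jk ki; [by right|left].
exact: perm3_trans t' (perm3_sym t).
Qed.

(** Neither type contains both [p] and [u], so no vertex meets edges of both colours. Yet [p]
    reaches every vertex: a triangle at an end of a [p] edge must have the first type, and two of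
    its three sides are [p]. *)
Lemma no_disjoint_isosceles p q u v : p <> u -> q <> u -> v <> p ->
  (exists x y, x != y /\ D x y = p) -> (exists x y, x != y /\ D x y = u) ->
  all_triples (fun a b c => perm3 a b c p p q \/ perm3 a b c u u v) -> False.
Proof.
move=> pu qu vp [x [x' [xx' xp]]] [y [y' [yy' yu]]] types.
have third (a b : T) : exists c, c != a /\ c != b.
  have [c] : exists c, c \notin [:: a; b] by exact: exists_notin (leq_trans _ T6).
  by rewrite !inE negb_or => /andP[]; exists c.
have no_pu a b c : a != b -> a != c -> D a b = p -> D a c = u -> False.
  move=> ab ac Ep Eu; have bc : b != c by apply/eqP => e; congruence.
  have := types a b c ab bc; rewrite eq_sym (DC c a) => /(_ ac).
  by case=> -[|[|[|[|[|]]]]] [] *; congruence.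
have all_p b : exists2 c, c != b & D b c = p.
  have [->|bx] := eqVneq b x; first by exists x'; rewrite // eq_sym.
  have [c [cx cb]] := third x b.
  have xb : x != b by rewrite eq_sym.
  have bc : b != c by rewrite eq_sym.
  have := types x b c xb bc cx.
  case=> H.
    by case: H => [|[|[|[|[|]]]]] [e1 e2 e3];
      first [by exists c | by exists x; rewrite // DC].
  have xc : x != c by rewrite eq_sym.
  by case: H => [|[|[|[|[|]]]]] [e1 e2 e3];
    first [exact: False_ind (no_pu x x' b xx' xb xp e1)
          |by case: (no_pu x x' c xx' xc xp); rewrite DC].
have [c cy yp] := all_p y.
apply: (no_pu y c y' _ yy' yp yu); by rewrite eq_sym.
Qed.

(** Otherwise every triangle is properly isosceles. Starting from a type [p p q], Ramsey gives a
    triangle without [p], which must have the other type [u u v], and then one without [u]; the two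
    types are then as [no_disjoint_isosceles] forbids. *)
Lemma mono_triangle : exists x y z p, [/\ x != y, y != z & z != x] /\
  [/\ D x y = p, D y z = p & D z x = p].
Proof.
apply: contrapT => nomono.
have mono x y z : x != y -> y != z -> z != x -> D x y = D y z -> D y z = D z x -> False.
  by move=> xy yz zx e1 e2; apply: nomono; exists x, y, z, (D x y); rewrite -e2 -e1.
have iso x y z : x != y -> y != z -> z != x ->
    exists p q, [/\ p <> q, perm3 (D x y) (D y z) (D z x) p p q
                  & exists x' y', x' != y' /\ D x' y' = p].
  move=> xy yz zx; have := mono x y z xy yz zx.
  case: (no_rainbow xy yz zx) => e m.
  - exists (D x y), (D z x); split; [by move=> e'; apply: m; congruence| |by exists x, y].
    by rewrite -e; left.
  - exists (D y z), (D x y); split; [by move=> e'; apply: m; congruence| |by exists y, z].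
    by rewrite -e; do 5?[by left | right].
  - exists (D z x), (D y z); split; [by move=> e'; apply: m; congruence| |by exists z, x].
    by rewrite -e; do 5?[by left | right].
have other p q s t r x y z : x != y -> y != z -> z != x -> p <> q ->
    perm3 (D x y) (D y z) (D z x) p p q ->
    (exists x' y', x' != y' /\ D x' y' = p) ->
    all_triples (fun a b c => perm3 a b c p p q \/ perm3 a b c s t r) -> False.
  move=> xy yz zx pq pxyz pE types.
  (* Ramsey for the colours equal to [p'] and different from [p']: the first kind of triangle would
     be equilateral. *)
  have avoid p' : exists x y z, [/\ x != y, y != z & z != x] /\
      [/\ D x y <> p', D y z <> p' & D z x <> p'].
    have eC : symmetric (fun a b => D a b == p') by move=> a b; rewrite DC.
    have [a [b [c [[ab bc ca] H]]]] := ramsey33 eC T6.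
    exists a, b, c; split=> //; case: H => [[/eqP e1 /eqP e2 /eqP e3]|[/eqP e1 /eqP e2 /eqP e3]] //.
    by exfalso; apply: (mono a b c) => //; congruence.
  have [a [b [c [[ab bc ca] [np1 np2 np3]]]]] := avoid p.
  have [u [v [uv puv uE]]] := iso a b c ab bc ca.
  have [up vp] : u <> p /\ v <> p.
    by case: puv => [|[|[|[|[|]]]]] [] *; split; congruence.
  have suv : perm3 s t r u u v.
    case: (types a b c) => // [|H]; last exact: perm3_trans (perm3_sym H) puv.
    by case=> [|[|[|[|[|]]]]] [] *; congruence.
  have types' : all_triples (fun a b c => perm3 a b c p p q \/ perm3 a b c u u v).
    move=> i j k ij jk ki; case: (types i j k) => // H; [by left|right].
    exact: perm3_trans H suv.
  (* A triangle without [u] has type [p p q], so its side [q] is not [u]. *)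
  have qu : q <> u.
    have [a' [b' [c' [[ab' bc' ca'] [nu1 nu2 nu3]]]]] := avoid u.
    by case: (types' a' b' c') => //; case=> [|[|[|[|[|]]]]] [] *; congruence.
  apply: (@no_disjoint_isosceles p q u v) => //; exact: nesym.
have [x _] : exists w : T, w \notin [::] by exact: exists_notin (leq_trans _ T6).
have [y] : exists w, w \notin [:: x] by exact: exists_notin (leq_trans _ T6).
rewrite !inE eq_sym => xy.
have [z] : exists w, w \notin [:: x; y] by exact: exists_notin (leq_trans _ T6).
rewrite !inE negb_or => /andP[zx zy]; have yz : y != z by rewrite eq_sym.
have [p [q [pq pxyz pE]]] := iso x y z xy yz zx.
have [t|t] := two_types xy yz zx.
  apply: (@other p q x2 y2 z2 x y z) => // i j k ij jk ki.
  have [t'|] := two_types ij jk ki; [left|by right].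
  exact: perm3_trans t' (perm3_trans (perm3_sym t) pxyz).
apply: (@other p q x1 y1 z1 x y z) => // i j k ij jk ki.
have [|t'] := two_types ij jk ki; [by right|left].
exact: perm3_trans t' (perm3_trans (perm3_sym t) pxyz).
Qed.

(** One type is [p p p] by [mono_triangle]; the other is isosceles, say [u u v]. The two
    alternatives are [u = p] and [v = p]; if neither holds, [p] is the only colour. *)
Lemma two_type_coloring : exists p,
  (exists v, all_triples (fun a b c => perm3 a b c p p p \/ perm3 a b c p p v)) \/
  (exists2 u, u <> p &
     all_triples (fun a b c => perm3 a b c p p p \/ perm3 a b c u u p)).
Proof.
have [x [y [z [p [[xy yz zx] [pxy pyz pzx]]]]]] := mono_triangle.
exists p.
have [s [t [r types]]] : exists s t r,
    all_triples (fun a b c => perm3 a b c p p p \/ perm3 a b c s t r).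
  have [T1|T1] := two_types xy yz zx; rewrite pxy pyz pzx in T1.
    exists x2, y2, z2 => i j k ij jk ki.
    have [t'|] := two_types ij jk ki; [left|by right].
    exact: perm3_trans t' (perm3_sym T1).
  exists x1, y1, z1 => i j k ij jk ki.
  have [|t'] := two_types ij jk ki; [by right|left].
  exact: perm3_trans t' (perm3_sym T1).
have [allp|] := pselect (all_triples (fun a b c => perm3 a b c p p p)).
  by left; exists p => i j k ij jk ki; left; apply: allp.
move=> /existsNP[i /existsNP[j /existsNP[k /not_implyP[ij /not_implyP[jk /not_implyP[ki np]]]]]].
have srt : perm3 (D i j) (D j k) (D k i) s t r by case: (types i j k).
have [u [v uuv]] : exists u v, perm3 s t r u u v.
  have [e|e|e] := no_rainbow ij jk ki.
  - by exists (D i j), (D k i); apply: perm3_trans (perm3_sym srt) _; rewrite -e; left.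
  - exists (D j k), (D i j); apply: perm3_trans (perm3_sym srt) _; rewrite -e.
    exact: perm3_rot.
  - exists (D k i), (D j k); apply: perm3_trans (perm3_sym srt) _; rewrite -e.
    exact: perm3_rotr.
have {srt}types' : all_triples (fun a b c => perm3 a b c p p p \/ perm3 a b c u u v).
  move=> a b c ab bc ca; case: (types a b c) => // H; [by left|right].
  exact: perm3_trans H uuv.
have [up|/eqP up] := eqVneq u p; first by left; exists v; rewrite up in types'.
have [vp|/eqP vp] := eqVneq v p; first by right; exists u => //; rewrite vp in types'.
exfalso; apply: np.
(* The type [u u v] now contains no [p], so a triangle with one side [p] has all sides [p], and the
   colour of [x y] spreads to every edge. *)
have spread a b c : a != b -> b != c -> c != a -> D a b = p ->
    D b c = p /\ D c a = p.
  move=> ab bc ca e; have := types' a b c ab bc ca; rewrite e.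
  by case=> -[|[|[|[|[|]]]]] [] *; split; congruence.
have xp w : w != x -> D x w = p.
  move=> wx; have [->//|wy] := eqVneq w y.
  by rewrite DC; case: (spread x y w) => //; rewrite eq_sym.
have ap a b : a != b -> D a b = p.
  move=> ab; have [e|ax] := eqVneq a x; first by rewrite e xp // -e eq_sym.
  have [e|bx] := eqVneq b x; first by rewrite e DC xp // -e.
  by case: (spread x a b) => //; rewrite ?xp // eq_sym.
by rewrite !ap //; left.
Qed.
End Coloring.

(** * Collinear triples *)

Lemma fset_exists_notin (K : choiceType) (P : {fset K}) (s : seq K) :
  (size s < #|` P|)%N -> exists2 t, t \in P & t \notin s.
Proof.
move=> lt_s; apply: contrapT => H; move: lt_s; rewrite ltnNge => /negP; apply.
apply: uniq_leq_size (fset_uniq _) _ => t tP.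
by apply: contrapT => /negP ts; apply: H; exists t.
Qed.

Section NoCollinear.
Variables (R : realType) (d : nat) (P : {fset 'rV[R]_d}).
Variables x1 y1 z1 x2 y2 z2 : R.
Implicit Types p v w x y z : 'rV[R]_d.

Lemma perm3_sum (a b c x y z : R) : perm3 a b c x y z -> a + b + c = x + y + z.
Proof. by case=> [|[|[|[|[|]]]]] [-> -> ->]; ring. Qed.

Lemma perm3_heron (a b c x y z : R) :
  perm3 a b c x y z -> heron a b c = heron x y z.
Proof. by case=> [|[|[|[|[|]]]]] [-> -> ->]; rewrite /heron; ring. Qed.

Lemma heron3_param p v (a b : R) w :
  heron3 (p + a *: v) (p + b *: v) w = (b - a) ^+ 2 * heron3 p (p + v) w.
Proof.
rewrite /heron3 /heron !sqdE !dotE ?(dotC v p) ?(dotC w p) ?(dotC w v); ring.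
Qed.

Lemma sqd_param p v (a b : R) :
  sqd (p + a *: v) (p + b *: v) = (a - b) ^+ 2 * dot v v.
Proof. by rewrite sqdE !dotE (dotC v p); ring. Qed.

Hypothesis two_types : forall x y z, x \in P -> y \in P -> z \in P ->
  heron3 x y z <> 0 ->
  perm3 (sqd x y) (sqd y z) (sqd z x) x1 y1 z1 \/
  perm3 (sqd x y) (sqd y z) (sqd z x) x2 y2 z2.

Hypothesis has_triangle : exists x y z,
  [/\ x \in P, y \in P, z \in P & heron3 x y z <> 0].

Lemma exists_off_line p v : v <> 0 -> exists2 w, w \in P & heron3 p (p + v) w <> 0.
Proof.
move=> v0; apply: contrapT => H.
have line w : w \in P -> exists t, w = p + t *: v.
  move=> wP; have [||t ->] := @heron3_eq0 R d p (p + v) w.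
  - by move=> /(congr1 (fun u => u - p)); rewrite subrr addrAC subrr add0r => /esym.
  - by apply: contrapT => nz; apply: H; exists w.
  - by exists t; rewrite addrAC subrr add0r.
have [x [y [z [/line[a ->] /line[b ->] /line[c ->]]]]] := has_triangle.
by apply; apply: heron3_line.
Qed.

(* The three triangles spanned by an apex [w] and two of the three collinear
   points have areas in proportion b-a, c-b and c-a, so the first two must be
   the congruent ones. *)
Lemma collinear_midpoint p v w (a b c : R) : a < b -> b < c ->
  p + a *: v \in P -> p + b *: v \in P -> p + c *: v \in P -> w \in P ->
  heron3 p (p + v) w <> 0 ->
  b - a = c - b /\ sqd w (p + a *: v) = sqd w (p + c *: v).
Proof.
move=> ab bc; set x := p + a *: v; set y := p + b *: v; set z := p + c *: v.
move=> xP yP zP wP; set h := heron3 p (p + v) w => h0.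
have hp : 0 < h by rewrite lt_def heron3_ge0 andbT; apply/eqP.
have ba : 0 < b - a by lra.
have cb : 0 < c - b by lra.
have hxy : heron3 x y w = (b - a) ^+ 2 * h by rewrite heron3_param.
have hyz : heron3 y z w = (c - b) ^+ 2 * h by rewrite heron3_param.
have hxz : heron3 x z w = (c - a) ^+ 2 * h by rewrite heron3_param.
have dba : (b - a) ^+ 2 < (c - a) ^+ 2 by nra.
have dcb : (c - b) ^+ 2 < (c - a) ^+ 2 by nra.
have lba : heron3 x y w < heron3 x z w by rewrite hxy hxz ltr_pM2r.
have lcb : heron3 y z w < heron3 x z w by rewrite hyz hxz ltr_pM2r.
have : perm3 (sqd x y) (sqd y w) (sqd w x) (sqd y z) (sqd z w) (sqd w y).
  have nz1 : heron3 x y w <> 0 by apply/eqP; rewrite hxy mulf_neq0 ?expf_neq0 ?gt_eqF.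
  have nz2 : heron3 y z w <> 0 by apply/eqP; rewrite hyz mulf_neq0 ?expf_neq0 ?gt_eqF.
  have nz3 : heron3 x z w <> 0 by apply/eqP; rewrite gt_eqF // (le_lt_trans _ lba) ?heron3_ge0.
  have t3 := two_types xP zP wP nz3.
  have [t1|t1] := two_types xP yP wP nz1; have [t2|t2] := two_types yP zP wP nz2;
    try exact: perm3_trans t1 (perm3_sym t2);
    case: t3 => t3; exfalso; move: lba lcb; rewrite /heron3;
    by rewrite (perm3_heron t1) (perm3_heron t2) (perm3_heron t3) ltxx.
move=> t; have := perm3_heron t; rewrite -!/(heron3 _ _ _) hxy hyz.
move=> /(mulIf (lt0r_neq0 hp)) /eqP; rewrite eqrXn2 // ?ltW // => /eqP bc'.
(* In the sums of squared sides the halves [x y] and [y z] are equal and the side [y w] is common,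
   which leaves the outer sides equal. *)
split=> //; have := perm3_sum t.
have -> : sqd x y = sqd y z.
  by rewrite !sqd_param -(sqrrN (b - c)) -(sqrrN (a - b)) !opprB bc'.
by rewrite (sqdC w y) (sqdC z w); lra.
Qed.

(** Turns a goal [False] into an order goal, to be closed by [lra]. *)
Let lt00 : (0 : R) < 0 -> False.
Proof. by rewrite ltxx. Qed.

Lemma midpoint_param p v (a b c : R) : v <> 0 -> a < b -> b < c ->
  p + a *: v \in P -> p + b *: v \in P -> p + c *: v \in P -> b - a = c - b.
Proof.
move=> v0 ab bc aP bP cP; have [w wP hw] := exists_off_line p v0.
by have [] := collinear_midpoint ab bc aP bP cP wP hw.
Qed.

(** Wherever a fourth point of the line lies, two triples share their middle and one outer point;
    the midpoint condition then makes the other outer points coincide. *)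
Lemma line_three_points p v w : v <> 0 -> p - v \in P -> p \in P -> p + v \in P ->
  w \in P -> w <> p - v -> w <> p -> w <> p + v -> heron3 p (p + v) w <> 0.
Proof.
move=> v0 xP yP zP wP wx wy wz h0.
have [|t] := heron3_eq0 _ h0.
  by move=> /(congr1 (fun u => u - p)); rewrite subrr addrAC subrr add0r => /esym.
rewrite addrAC subrr add0r => wE.
have x' : p - v = p + (-1) *: v by rewrite scaleN1r.
have y' : p = p + 0 *: v by rewrite scale0r addr0.
have z' : p + v = p + 1 *: v by rewrite scale1r.
rewrite {}x' in xP wx; rewrite {1}z' in zP; rewrite z' in wz.
have {}yP : p + 0 *: v \in P by rewrite -y'.
have {}wy : w <> p + 0 *: v by rewrite -y'.
rewrite wE in wP wx wy wz.
have tx : t != -1 by apply/eqP => e; apply: wx; rewrite e.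
have ty : t != 0 by apply/eqP => e; apply: wy; rewrite e.
have tz : t != 1 by apply/eqP => e; apply: wz; rewrite e.
have mid := fun a b c ab bc => @midpoint_param p v a b c v0 ab bc.
have m10 : -1 < 0 :> R by rewrite oppr_lt0 ltr01.
have m11 : -1 < 1 :> R by apply: lt_trans m10 ltr01.
have l01 : 0 < 1 :> R by exact: ltr01.
have [t1|t1|/eqP] := ltgtP t (-1); last by rewrite (negPf tx).
  move: (mid _ _ _ t1 m10 wP xP yP) (mid _ _ _ t1 m11 wP xP zP).
  by move=> *; apply: lt00; lra.
have [t0|t0|/eqP] := ltgtP t 0; last by rewrite (negPf ty).
  move: (mid _ _ _ t1 t0 xP wP yP) (mid _ _ _ t1 (lt_trans t0 l01) xP wP zP).
  by move=> *; apply: lt00; lra.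
have [t2|t2|/eqP] := ltgtP t 1; last by rewrite (negPf tz).
  move: (mid _ _ _ t0 t2 yP wP zP) (mid _ _ _ t1 t2 xP wP zP) (t0).
  by move=> *; apply: lt00; lra.
move: (mid _ _ _ l01 t2 yP zP wP) (mid _ _ _ m11 t2 xP zP wP).
by move=> *; apply: lt00; lra.
Qed.

Hypothesis P6 : (6 <= #|` P|)%N.

(** For [w] off the line, the half and the whole segment span triangles with squared sides
    [q, q + k, k] and [4q, q + k, q + k]. Their Heron values [4qk] and [16qk] differ, so these are
    the two types, and a pair of non-antipodal points [w], [w'] yields the value [12qk]. *)
Lemma no_symmetric_triple p v : v <> 0 ->
  p - v \in P -> p \in P -> p + v \in P -> False.
Proof.
move=> v0 xP yP zP.
set q := dot v v.
have qp : 0 < q by rewrite lt_def dot_ge0 andbT; apply/eqP => /dot_eq0.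
pose off w := [/\ w \in P, w <> p - v, w <> p & w <> p + v].
have off_heron w : off w -> heron3 p (p + v) w <> 0.
  by case=> wP wx wy wz; apply: line_three_points.
have off_orth w : off w -> dot (w - p) v = 0.
  move=> ow; have [wP _ _ _] := ow.
  have m10 : -1 < 0 :> R by rewrite oppr_lt0 ltr01.
  have [] := @collinear_midpoint p v w (-1) 0 1 m10 ltr01;
    rewrite ?scaleN1r ?scale0r ?addr0 ?scale1r //; first exact: off_heron.
  by rewrite !sqdE !dotE (dotC v p) => _ ?; lra.
pose k w := sqd w p.
have off_k w : off w -> 0 < k w by case=> _ _ wy _; apply: sqd_gt0.
have hyw w : off w -> heron3 p (p + v) w = 4 * (q * k w).
  move=> ow; rewrite heron3E addrAC subrr add0r (dotC v) off_orth //.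
  by rewrite /k /sqd /q; ring.
have hzw w : off w -> heron3 (p - v) (p + v) w = 16 * (q * k w).
  move=> ow; rewrite -(scaleN1r v) -[in X in heron3 _ X](scale1r v) heron3_param hyw //.
  by ring.
have qk w : off w -> 0 < q * k w by move=> ow; rewrite mulr_gt0 ?off_k.
have dxw w : off w -> sqd w (p - v) = q + k w.
  move=> ow; have := off_orth _ ow; rewrite /q /k !sqdE !dotE => ?.
  by rewrite (dotC v p); lra.
have dzw w : off w -> sqd w (p + v) = q + k w.
  move=> ow; have := off_orth _ ow; rewrite /q /k !sqdE !dotE => ?.
  by rewrite (dotC v p); lra.
have dyz : sqd p (p + v) = q by rewrite /q sqdE !dotE (dotC v p); ring.
have dxz : sqd (p - v) (p + v) = 4 * q by rewrite /q sqdE !dotE (dotC v p); ring.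
have types w a b c : off w -> a \in P -> b \in P -> c \in P -> heron3 a b c <> 0 ->
    perm3 (sqd a b) (sqd b c) (sqd c a) q (q + k w) (k w) \/
    perm3 (sqd a b) (sqd b c) (sqd c a) (4 * q) (q + k w) (q + k w).
  move=> ow aP bP cP abc; have [wP _ _ _] := ow; have K := qk w ow.
  have nz : heron3 (p - v) (p + v) w <> 0 by rewrite hzw // => ?; apply: lt00; lra.
  have := hzw _ ow; have := hyw _ ow; rewrite /heron3.
  have := two_types xP zP wP nz; have := two_types yP zP wP (off_heron w ow).
  rewrite dyz dxz dxw // (sqdC (p + v)) dzw // -/(k w).
  have abc' := two_types aP bP cP abc.
  case=> T1 [] T2 H1 H2.
  - by have := perm3_heron T1; have := perm3_heron T2; rewrite H1 H2 => <- ?; case: lt00; lra.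
  - case: abc' => T3; [left; exact: perm3_trans T3 (perm3_sym T1)|].
    right; exact: perm3_trans T3 (perm3_sym T2).
  - case: abc' => T3; [right; exact: perm3_trans T3 (perm3_sym T2)|].
    left; exact: perm3_trans T3 (perm3_sym T1).
  - by have := perm3_heron T1; have := perm3_heron T2; rewrite H1 H2 => <- ?; case: lt00; lra.
have herons w a b c : off w -> a \in P -> b \in P -> c \in P -> heron3 a b c <> 0 ->
    heron3 a b c = 4 * (q * k w) \/ heron3 a b c = 16 * (q * k w).
  move=> ow aP bP cP abc; rewrite /heron3.
  have [/perm3_heron->|/perm3_heron->] := types w a b c ow aP bP cP abc;
    [left|right]; rewrite /heron; ring.
(* Both values [4qk'] and [16qk'] arising from [w'] must lie among [4qk] and [16qk]. *)
have same_k w w' : off w -> off w' -> k w = k w'.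
  move=> ow ow'; have [wP _ _ _] := ow'.
  have nz : heron3 (p - v) (p + v) w' <> 0 by have := qk _ ow'; rewrite hzw // => ? ?; apply: lt00; lra.
  apply: (mulfI (lt0r_neq0 qp)); have K := qk w ow; have K' := qk w' ow'.
  have := herons w _ _ _ ow yP zP wP (off_heron _ ow').
  have := herons w _ _ _ ow xP zP wP nz; rewrite hyw // hzw //.
  by case=> ? [] ?; lra.
have no_pair w w' : off w -> off w' -> w <> w' -> w' <> p + p - w -> False.
  move=> ow ow' ww ww'; have [wP _ wy _] := ow; have [wP' _ _ _] := ow'.
  have kE := same_k _ _ ow ow'; have kp := off_k _ ow; set h := k w in kE kp.
  set g := sqd w w'.
  have nz : heron3 p w w' <> 0.
    move=> /heron3_eq0[|t wE]; first exact: nesym.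
    have : k w' = t ^+ 2 * h by rewrite /h /k wE !sqdE !dotE (dotC w p); ring.
    rewrite -kE => /eqP; rewrite -subr_eq0 -{1}(mul1r h) -mulrBl mulf_eq0 (gt_eqF kp) orbF.
    rewrite subr_eq0 eq_sym sqrf_eq1 => /orP[]/eqP t1; move: wE; rewrite t1.
      by rewrite scale1r addrC subrK => e; apply: ww.
    by rewrite scaleN1r opprB addrA.
  (* The sides [h, g, h] cannot be [4q, q + h, q + h], since [h < q + h]; matching [q, q + h, h]
     leaves only this. *)
  have gE : q = h /\ g = 2 * h.
    have := types w _ _ _ ow yP wP wP' nz.
    rewrite (sqdC p w) -/(k w) -/(k w') -kE -/h -/g.
    by case=> -[|[|[|[|[|]]]]] [] => *; split; lra.
  case: gE => qh gE.
  (* This triangle is equilateral with squared side [2h]. *)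
  have hE : heron3 (p - v) w w' = 12 * (q * h).
    by rewrite /heron3 (sqdC _ w) !dxw // -/g -kE -/h qh gE /heron; ring.
  have nz' : heron3 (p - v) w w' <> 0 by rewrite hE; have := qk _ ow; rewrite -/h => ? ?; apply: lt00; lra.
  have := herons w _ _ _ ow xP wP wP' nz'; rewrite hE -/h.
  by have := qk _ ow; rewrite -/h => ? [] ?; apply: lt00; lra.
(* Six points leave three outside the triple, and at most one of the last two is antipodal to the
   first. *)
have pick s : (size s < 3)%N -> exists2 w, off w & w \notin s.
  move=> s3; have [|w wP] := @fset_exists_notin _ P (p - v :: p :: p + v :: s).
    by apply: leq_trans P6; rewrite /= !ltnS.
  rewrite !inE !negb_or => /and4P[/eqP wx /eqP wy /eqP wz ws]; by exists w.
have [w1 o1 _] := pick [::] isT.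
have [w2 o2] := pick [:: w1] isT; rewrite !inE => /eqP w21.
have [w3 o3] := pick [:: w1; w2] isT; rewrite !inE negb_or => /andP[/eqP w31 /eqP w32].
have [e|/eqP ne] := eqVneq w2 (p + p - w1).
  by apply: (no_pair w1 w3) => //; [exact: nesym|rewrite -e].
by apply: (no_pair w1 w2) => //; exact: nesym.
Qed.

(** The order of [0], [1] and [t] tells which point is in the middle; being the midpoint, it is the
    centre of a symmetric triple. *)
Lemma no_collinear x y z : x \in P -> y \in P -> z \in P ->
  x <> y -> y <> z -> z <> x -> heron3 x y z <> 0.
Proof.
move=> xP yP zP xy yz zx /(heron3_eq0 xy)[t zE].
pose v := y - x.
have v0 : v <> 0 by move=> /eqP; rewrite subr_eq0 => /eqP/esym.
have xP' : x + 0 *: v \in P by rewrite scale0r addr0.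
have yP' : x + 1 *: v \in P by rewrite scale1r addrC subrK.
have zP' : x + t *: v \in P by rewrite -zE.
have mid a b c : a < b -> b < c -> x + a *: v \in P -> x + b *: v \in P ->
    x + c *: v \in P -> False.
  move=> ab bc aP bP cP; have m := midpoint_param v0 ab bc aP bP cP.
  apply: (@no_symmetric_triple (x + b *: v) ((b - a) *: v)) => //.
  - move=> /eqP; rewrite scaler_eq0 subr_eq0 gt_eqF //= => /eqP; exact: v0.
  - by rewrite -addrA -scalerBl subKr.
  - by rewrite m -addrA -scalerDl [b + _]addrC subrK.
have [t0|t0|t0] := ltgtP t 0.
- exact: (mid t 0 1).
- have [t1|t1|t1] := ltgtP t 1.
  + exact: (mid 0 t 1).
  + exact: (mid 0 1 t).
  + by apply: yz; rewrite zE t1 scale1r addrC subrK.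
- by apply: zx; rewrite zE t0 scale0r addr0.
Qed.

End NoCollinear.

(** * Bounds from the distance form *)

Section LinearBounds.
Variables (R : realType) (T : finType).

(** Linear independence of the vectors indexed by [A], with coefficients defined on all of [T] and
    vanishing off [A] so that callers need no reindexing. *)
Lemma card_le_dim e (w : T -> 'rV[R]_e) (A : {set T}) :
  (forall c : T -> R, (forall t, t \notin A -> c t = 0) ->
     \sum_t c t *: w t = 0 -> forall t, c t = 0) ->
  (#|A| <= e)%N.
Proof.
move=> H; pose W := \matrix_(i < #|A|) w (enum_val i).
suff /eqP <- : row_free W by apply: rank_leq_col.
apply: inj_row_free => u uW.
(* At most one term occurs, and none when [t] is outside [A]. *)
pose c t := \sum_(i < #|A| | enum_val i == t) u 0 i.
have cE i : c (enum_val i) = u 0 i.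
  by rewrite /c (big_pred1 i) // => j; rewrite (inj_eq enum_val_inj).
apply/rowP => i; rewrite mxE -cE; apply: H => [t tA|].
  by apply: big1 => j /eqP jt; move: tA; rewrite -jt enum_valP.
rewrite -[RHS]uW mulmx_sum_row [RHS](partition_big enum_val predT) //=.
apply: eq_bigr => t _; rewrite scaler_suml; apply: eq_bigr => j /eqP <-.
by rewrite rowK.
Qed.

Variables (d : nat) (pt : T -> 'rV[R]_d).
Let D i j := sqd (pt i) (pt j).

(* If sum c = 0 and sum c x = 0 then sum_ij c_i c_j |x_i - x_j|^2 = 0. *)
Lemma distance_form_bound (A : {set T}) :
  (forall c : T -> R, \sum_(t in A) c t = 0 -> \sum_(t in ~: A) c t = 0 ->
     \sum_i c i * \sum_j c j * D i j = 0 -> forall t, c t = 0) ->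
  (#|T| <= d + 2)%N.
Proof.
move=> H.
(* The two extra coordinates are the indicators of [A] and its complement, so a linear dependency
   has coefficient sum zero on each block. *)
pose w t : 'rV[R]_(d + (1 + 1)) :=
  row_mx (pt t) (row_mx (t \in A)%:R%:M (t \notin A)%:R%:M).
rewrite -cardsT -[2%N]/(1 + 1)%N; apply: (card_le_dim (w := w)) => c _.
rewrite (eq_bigr (fun t => row_mx (c t *: pt t)
    (row_mx (c t * (t \in A)%:R)%:M (c t * (t \notin A)%:R)%:M))); last first.
  by move=> t _; rewrite /w !scale_row_mx !scale_scalar_mx.
move=> H0.
have cx : \sum_t c t *: pt t = 0.
  have := congr1 lsubmx H0; rewrite linear0 linear_sum /=.
  by under eq_bigr do rewrite row_mxKl.
have cA0 : \sum_t c t * (t \in A)%:R = 0.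
  have := congr1 (fun M : 'rV_(d + (1 + 1)) => M 0 (rshift d (lshift 1 0))) H0.
  rewrite summxE [RHS]mxE => E; rewrite -[RHS]E; apply: eq_bigr => t _.
  by rewrite row_mxEr row_mxEl mxE eqxx mulr1n.
have cB0 : \sum_t c t * (t \notin A)%:R = 0.
  have := congr1 (fun M : 'rV_(d + (1 + 1)) => M 0 (rshift d (rshift 1 0))) H0.
  rewrite summxE [RHS]mxE => E; rewrite -[RHS]E; apply: eq_bigr => t _.
  by rewrite row_mxEr row_mxEr mxE eqxx mulr1n.
have cA : \sum_(t in A) c t = 0.
  by rewrite -[RHS]cA0 big_mkcond; apply: eq_bigr => t _; case: ifP; rewrite (mulr1, mulr0).
have cB : \sum_(t in ~: A) c t = 0.
  rewrite -[RHS]cB0 big_mkcond; apply: eq_bigr => t _; rewrite inE.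
  by case: ifP; rewrite (mulr1, mulr0).
apply: H => //.
have c0 : \sum_t c t = 0.
  rewrite (bigID (mem A)) /= cA add0r -[RHS]cB; apply: eq_bigl => t.
  by rewrite inE.
(* Expanding the squared distance shows that the inner sum equals [N] for every [i]. *)
pose N := \sum_j c j * dot (pt j) (pt j).
transitivity (\sum_i c i * N); last by rewrite -mulr_suml c0 mul0r.
apply: eq_bigr => i _; congr (_ * _).
transitivity (\sum_j (c j * dot (pt i) (pt i) + (c j * dot (pt j) (pt j) -
   2 * dot (c j *: pt j) (pt i)))).
  by apply: eq_bigr => j _; rewrite /D sqdE dotZl (dotC (pt j)); ring.
rewrite !big_split /= -mulr_suml c0 mul0r add0r -/N sumrN -mulr_sumr.
by rewrite -dot_suml cx dot0l mulr0 subr0.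
Qed.

(** Up to its diagonal the distance matrix is constant on blocks, and such a part is killed by [c].
    What remains of the form is minus the sum of [kap i * c i ^+ 2], which is negative definite. *)
Lemma two_block_bound (A : {set T}) (a b g : R) : 0 < a -> 0 < b ->
  (forall i j, i \in A -> j \in A -> i != j -> D i j = a) ->
  (forall i j, i \notin A -> j \notin A -> i != j -> D i j = b) ->
  (forall i j, i \in A -> j \notin A -> D i j = g) ->
  (#|T| <= d + 2)%N.
Proof.
move=> a0 b0 HA HB HG; apply: (@distance_form_bound A) => c cA cB.
pose kap i := if i \in A then a else b.
have kap0 i : 0 < kap i by rewrite /kap; case: ifP.
have inner i : \sum_j c j * D i j = - (kap i * c i).
  have split (x y : R) :
      \sum_j c j * (if j \in A then x else y) = 0.
    rewrite (bigID (mem A)) /=.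
    rewrite (eq_bigr (fun j => c j * x)) => [|j ->] //.
    rewrite [X in _ + X](eq_bigr (fun j => c j * y)) => [|j /negPf->] //.
    rewrite -!mulr_suml cA mul0r add0r.
    by rewrite (eq_bigl (mem (~: A))) ?cB ?mul0r // => j; rewrite !inE.
  have eD j : c j * D i j = c j * (if j \in A then if i \in A then a else g
      else if i \in A then g else b) - (if j == i then kap i * c i else 0).
    have [->|ji] := eqVneq j i.
      by rewrite /D sqdxx /kap; case: (i \in A); ring.
    rewrite subr0; congr (_ * _).
    case jA: (j \in A); case iA: (i \in A).
    - by rewrite HA // eq_sym.
    - by rewrite /D sqdC -/(D j i) HG ?iA.
    - by rewrite HG ?jA.
    - by rewrite HB ?iA ?jA // eq_sym.
  rewrite (eq_bigr _ (fun j _ => eD j)) big_split /= split add0r sumrN.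
  by rewrite -big_mkcond big_pred1_eq.
under eq_bigr do rewrite inner mulrN.
rewrite sumrN => /eqP; rewrite oppr_eq0 psumr_eq0 => [/allP H t|i _]; last first.
  by rewrite mulrCA mulr_ge0 ?(ltW (kap0 i)) // -expr2 sqr_ge0.
have := H t (mem_index_enum t).
by rewrite mulrCA mulf_eq0 gt_eqF //= -expr2 sqrf_eq0 => /eqP.
Qed.

(** With J the all-ones matrix, the distance matrix is p (J - I) + b M, where [b = v - p] and M is
    the matrix of a matching. As M has norm at most 1 and [|b| < p], the form is negative definite
    on coefficients of sum zero. *)
Lemma matching_bound (p v : R) : 0 < v -> v < 2 * p ->
  (forall i j, i != j -> D i j = p \/ D i j = v) ->
  (forall i j k, i != j -> i != k -> D i j = v -> D i k = v -> v <> p -> j = k) ->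
  (#|T| <= d + 2)%N.
Proof.
move=> v0 vp HD Hm; have p0 : 0 < p by lra.
pose b := v - p; have bp : `|b| < p by rewrite /b ltr_norml; apply/andP; split; lra.
(* If [v = p] the matching is taken to be empty. *)
pose M i j := [&& i != j, D i j == v & v != p].
have MC i j : M i j = M j i by rewrite /M eq_sym /D sqdC.
have M1 i : \sum_j (M i j)%:R <= 1 :> R.
  have [j Mij|no] := pickP (M i); last first.
    by rewrite big1 // => j _; rewrite no.
  rewrite (bigD1 j) //= big1 ?addr0 ?lern1 ?leq_b1 // => k kj.
  case Mik : (M i k) => //; move: Mij Mik kj => /and3P[ij /eqP Dij /eqP nvp].
  by move=> /and3P[ik /eqP Dik _]; rewrite (Hm i j k) ?eqxx.
(* With an empty first block the only constraint is that [c] sums to zero. *)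
apply: (@distance_form_bound set0) => c _.
rewrite (eq_bigl predT) => [c0|t]; last by rewrite !inE.
pose Q := \sum_i c i ^+ 2.
have DE i j : D i j = p - p * (j == i)%:R + b * (M i j)%:R.
  rewrite /M; have [->|ji] := eqVneq j i; first by rewrite /D sqdxx /=; ring.
  have := HD i j; rewrite eq_sym => /(_ ji).
  have [->|Dv] := eqVneq (D i j) v; rewrite /b /=.
    by have [<-|_] := eqVneq v p => _ /=; ring.
  by case=> [->|e]; [ring | rewrite e eqxx in Dv].
have QE : \sum_i c i * \sum_j c j * D i j =
    - (p * Q) + \sum_i \sum_j (b * (M i j)%:R) * (c i * c j).
  rewrite /Q mulr_sumr -sumrN -big_split /=; apply: eq_bigr => i _.
  under eq_bigr do rewrite DE !mulrDr.
  rewrite !big_split /= -mulr_suml c0 mul0r add0r mulrDr; congr (_ + _).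
    rewrite (bigD1 i) //= eqxx big1 => [|j /negPf->] /=; ring.
  by rewrite mulr_sumr; apply: eq_bigr => j _; ring.
have S1 : \sum_i \sum_j (M i j)%:R * c i ^+ 2 <= Q.
  apply: ler_sum => i _; rewrite -mulr_suml -[leRHS]mul1r.
  by rewrite ler_wpM2r ?sqr_ge0.
have S2 : \sum_i \sum_j (M i j)%:R * c j ^+ 2 <= Q.
  by rewrite exchange_big /=; under eq_bigr do under eq_bigr do rewrite MC.
(* The arithmetic-geometric mean inequality on each matched pair, then the row and column sums of
   [M]. *)
have SE : \sum_i \sum_j (b * (M i j)%:R) * (c i * c j) <= `|b| * Q.
  apply: (@le_trans _ _ (\sum_i \sum_j (`|b| / 2 *
     ((M i j)%:R * c i ^+ 2) + `|b| / 2 * ((M i j)%:R * c j ^+ 2)))).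
    apply: ler_sum => i _; apply: ler_sum => j _; case: (M i j) => /=; last by rewrite !(mulr0, mul0r) addr0.
    have b1 : 0 <= `|b| - b by rewrite subr_ge0 ler_norm.
    have b2 : 0 <= `|b| + b by rewrite -[b in X in _ + X]opprK subr_ge0 -normrN ler_norm.
    rewrite -subr_ge0.
    have -> : `|b| / 2 * (1 * c i ^+ 2) + `|b| / 2 * (1 * c j ^+ 2) - b * 1 * (c i * c j) =
      ((`|b| + b) * (c i - c j) ^+ 2 + (`|b| - b) * (c i + c j) ^+ 2) / 4 by field.
    by rewrite divr_ge0 // addr_ge0 // mulr_ge0 // sqr_ge0.
  under eq_bigr do rewrite big_split /= -!mulr_sumr.
  rewrite big_split /= -!mulr_sumr; have b0 : 0 <= `|b| := normr_ge0 b.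
  by nra.
rewrite QE => /eqP; rewrite addrC subr_eq0 => /eqP E t.
have Q0 : 0 <= Q by apply: sumr_ge0 => i _; rewrite sqr_ge0.
have : Q = 0 by nra.
move=> /eqP; rewrite psumr_eq0 => [/allP/(_ t (mem_index_enum t))|i _]; last exact: sqr_ge0.
by rewrite sqrf_eq0 => /eqP.
Qed.
End LinearBounds.

(** * The orthoplex *)

Section Orthoplex.
Variables (R : realType) (d : nat) (P : {fset 'rV[R]_d}).
Implicit Types x y z m : 'rV[R]_d.

Lemma similarity_frame m (u : 'I_d -> 'rV[R]_d) (q : R) : 0 < q ->
  (forall i j, dot (u i) (u j) = if i == j then q else 0) ->
  is_similarity (fun x => m + \sum_i x 0 i *: u i).
Proof.
move=> q0 uE; exists (Num.sqrt q); first by rewrite sqrtr_gt0.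
move=> x y; rewrite !edistE -sqrtrM ?ltW //; congr Num.sqrt.
rewrite /sqd opprD addrACA subrr add0r -sumrB.
under eq_bigr do rewrite -scalerBl.
rewrite dot_suml mulr_sumr; apply: eq_bigr => i _.
rewrite dotZl dot_sumr (bigD1 i) //= big1 => [|j /negPf ji].
  by rewrite dotZr uE eqxx !mxE; ring.
by rewrite dotZr uE eq_sym ji mulr0.
Qed.

Lemma card_std_orthoplex_image (f : 'rV[R]_d -> 'rV[R]_d) :
  (#|` [fset f x | x in std_orthoplex R d]| <= 2 * d)%N.
Proof.
apply: leq_trans (leq_imfset_card _ _ _) _.
apply: leq_trans (leq_of_leqif (leq_card_fsetU _ _)) _; rewrite mul2n -addnn.
by apply: leq_add; apply: leq_trans (leq_imfset_card _ _ _) _; rewrite /= size_enum_ord.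
Qed.

Variables (p : R).
Hypothesis p0 : 0 < p.
Hypothesis dist : forall x y, x \in P -> y \in P -> x <> y ->
  sqd x y = p \/ sqd x y = 2 * p.
Hypothesis matching : forall x y z, x \in P -> y \in P -> z \in P ->
  sqd x y = 2 * p -> sqd x z = 2 * p -> y = z.
Hypothesis edge : exists x y, [/\ x \in P, y \in P & sqd x y = 2 * p].

(** Take the midpoint of one pair [a], [b] at squared distance [2p]. All other points are at squared
    distance [p] from both, so the median formula puts every point at squared distance [p / 2] from
    [m]; polarization gives the rest. *)
Lemma orthoplex_center : exists m,
  [/\ forall x, x \in P -> dot (x - m) (x - m) = p / 2,
      forall x y, x \in P -> y \in P -> sqd x y = p -> dot (x - m) (y - m) = 0 &
      forall x y, x \in P -> y \in P -> sqd x y = 2 * p -> y - m = - (x - m)].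
Proof.
have [a [b [aP bP ab]]] := edge.
have [m mE] : exists m, m = 2^-1 *: (a + b) by eexists.
exists m.
have norm x : x \in P -> dot (x - m) (x - m) = p / 2.
  move=> xP.
  have -> : dot (x - m) (x - m) = (sqd x a + sqd x b) / 2 - sqd a b / 4.
    by rewrite mE !sqdE !dotE ?(dotC a x) ?(dotC b x) ?(dotC b a); field.
  rewrite ab.
  have [->|/eqP xa] := eqVneq x a; first by rewrite sqdxx ab; field.
  have [->|/eqP xb] := eqVneq x b; first by rewrite sqdxx sqdC ab; field.
  have -> : sqd x a = p.
    have [//|e] := dist xP aP xa; case: xb; apply: (@matching a) => //.
    by rewrite sqdC.
  have -> : sqd x b = p.
    have [//|e] := dist xP bP xb; case: xa.
    by apply: (@matching b) => //; rewrite sqdC.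
  by field.
have dotm x y : dot (x - m) (y - m) =
    (dot (x - m) (x - m) + dot (y - m) (y - m) - sqd x y) / 2.
  by rewrite sqdE !dotE ?(dotC y x) ?(dotC m x) ?(dotC m y); field.
split=> // [x y xP yP e|x y xP yP e]; first by rewrite (dotm x y) !norm // e; field.
apply/eqP; rewrite -addr_eq0; apply/eqP/dot_eq0.
have sqD (u v : 'rV[R]_d) : dot (u + v) (u + v) = dot u u + dot v v + 2 * dot u v.
  by rewrite !dotE (dotC v u); ring.
by rewrite sqD (dotm y x) !norm // sqdC e; field.
Qed.

(** One point from each matched pair gives orthogonal vectors around [m], hence at most [d] of them;
    the lower bound on the size of [P] forces exactly [d], and they form the frame of the
    similarity. *)
Lemma orthoplex_of_matching : (2 * d <= #|` P|)%N ->
  regular_orthoplex P /\ (#|` P| <= 2 * d)%N.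
Proof.
move=> P2d; have [m [norm orth anti]] := orthoplex_center.
pose D (i j : P) := sqd (val i) (val j).
(* From each pair at squared distance [2p] the point of lower rank is kept, as is every unmatched
   point. *)
pose S := [set i : P | [forall j : P, (D i j == 2 * p) ==> (enum_rank i <= enum_rank j)%N]].
have DC i j : D i j = D j i by rewrite /D sqdC.
have SD i j : i \in S -> j \in S -> i != j -> D i j = p.
  rewrite !inE => /forallP Si /forallP Sj ij.
  have nij : val i <> val j by move=> /val_inj/eqP; rewrite (negPf ij).
  have [//|e] := dist (valP i) (valP j) nij.
  have := Si j; rewrite [D i j]e eqxx /= => le1.
  have := Sj i; rewrite DC [D i j]e eqxx /= => le2.
  have /enum_rank_inj/eqP : enum_rank i = enum_rank j.
    by apply/val_inj/eqP; rewrite eqn_leq le1.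
  by rewrite (negPf ij).
have Sd : (#|S| <= d)%N.
  apply: (@card_le_dim _ _ _ (fun i : P => val i - m)) => c cS c0 t.
  have [tS|/cS//] := boolP (t \in S).
  have := congr1 (fun u => dot u (val t - m)) c0; rewrite dot0l dot_suml.
  rewrite (bigD1 t) //= big1 => [|j jt].
    rewrite dotZl norm ?(valP t) // addr0 => /eqP.
    by rewrite mulf_eq0 [X in _ || X]gt_eqF ?divr_gt0 // orbF => /eqP.
  rewrite dotZl; have [jS|/cS->] := boolP (j \in S); last by rewrite mul0r.
  by rewrite (orth _ _ (valP j) (valP t)) ?mulr0 //; apply: SD.
(* The default concerns unmatched points only, and these lie in [S]. *)
pose partner (i : P) := odflt i [pick j : P | D i j == 2 * p].
have partnerP i : i \notin S -> D i (partner i) = 2 * p /\ partner i \in S.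
  rewrite inE negb_forall => /existsP[j]; rewrite negb_imply => /andP[/eqP ij].
  rewrite -ltnNge => ltji; rewrite /partner; case: pickP => [k /eqP ik|/(_ j)]; last first.
    by rewrite ij eqxx.
  split=> //=; have jk : j = k.
    by apply: val_inj; apply: matching (valP i) (valP j) (valP k) ij ik.
  rewrite inE; apply/forallP => l; apply/implyP => /eqP kl.
  have -> : l = i.
    apply: val_inj; apply: matching (valP k) (valP l) (valP i) kl _.
    by rewrite sqdC.
  by rewrite -jk ltnW.
have cardS : (#|` P| <= 2 * #|S|)%N.
  rewrite cardfE -(cardsC S) mul2n -addnn leq_add2l.
  have pinj : {in ~: S &, injective partner}.
    move=> i j; rewrite !in_setC => /partnerP[e1 _] /partnerP[e2 _] e.
    rewrite DC in e1; rewrite DC -e in e2.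
    by apply: val_inj; apply: matching (valP _) (valP i) (valP j) e1 e2.
  rewrite -(card_in_imset pinj) subset_leq_card //.
  by apply/subsetP => k /imsetP[i]; rewrite in_setC => /partnerP[_ ?] ->.
have Sd' : #|S| = d.
  apply/eqP; rewrite eqn_leq Sd /= -(leq_pmul2l (isT : (0 < 2)%N)).
  exact: leq_trans P2d cardS.
pose s (i : 'I_d) : P := enum_val (cast_ord (esym Sd') i).
pose u (i : 'I_d) := val (s i) - m.
have uE i j : dot (u i) (u j) = if i == j then p / 2 else 0.
  have [->|ij] := eqVneq i j; first exact: norm (valP _).
  apply: orth (valP _) (valP _) _; apply: SD; rewrite ?enum_valP //.
  by rewrite (inj_eq enum_val_inj) (inj_eq (@cast_ord_inj _ _ _)).
pose f x := m + \sum_i x 0 i *: u i.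
have fsim : is_similarity f by apply: similarity_frame uE; rewrite divr_gt0.
have fdelta (k : 'I_d) : f (delta_mx 0 k) = val (s k).
  rewrite /f (bigD1 k) //= big1 => [|j jk].
    by rewrite mxE !eqxx scale1r addr0 /u addrC subrK.
  by rewrite mxE eqxx (negPf jk) scale0r.
have fNdelta (k : 'I_d) : f (- delta_mx 0 k) = m - u k.
  rewrite /f (bigD1 k) //= big1 => [|j jk].
    by rewrite !mxE !eqxx scaleN1r addr0.
  by rewrite !mxE eqxx (negPf jk) oppr0 scale0r.
have sP (j : P) : j \in S -> exists k, s k = j.
  move=> jS; exists (cast_ord Sd' (enum_rank_in jS j)).
  by rewrite /s cast_ordK enum_rankK_in.
have sub : P `<=` [fset f x | x in std_orthoplex R d].
  apply/fsubsetP => x xP; pose i : P := FSetSub xP.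
  have -> : x = val i by [].
  have [iS|/partnerP[e /sP[k sk]]] := boolP (i \in S).
    have [k sk] := sP i iS; apply/imfsetP; exists (delta_mx 0 k) => /=.
      by rewrite in_fsetU; apply/orP; left; apply/imfsetP; exists k.
    by rewrite fdelta sk.
  apply/imfsetP; exists (- delta_mx 0 k) => /=.
    by rewrite in_fsetU; apply/orP; right; apply/imfsetP; exists k.
  by rewrite fNdelta /u sk (anti _ _ (valP i) (valP (partner i)) e) opprK addrC subrK.
have cardP := leq_trans (fsubset_leq_card sub) (card_std_orthoplex_image f).
split=> //; exists f => //; apply/eqP; rewrite eqEfcard sub /=.
exact: leq_trans (card_std_orthoplex_image f) P2d.
Qed.
End Orthoplex.

(** * From two triangle types to the orthoplex *)

Section TwoTypes.
Variables (R : realType) (d : nat) (P : {fset 'rV[R]_d}).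
Variables x1 y1 z1 x2 y2 z2 : R.
Implicit Types x y z : 'rV[R]_d.

Hypothesis d3 : (3 <= d)%N.
Hypothesis P2d : (2 * d <= #|` P|)%N.
Hypothesis two_types : forall x y z, x \in P -> y \in P -> z \in P ->
  heron3 x y z <> 0 ->
  perm3 (sqd x y) (sqd y z) (sqd z x) x1 y1 z1 \/
  perm3 (sqd x y) (sqd y z) (sqd z x) x2 y2 z2.
Hypothesis has_triangle : exists x y z,
  [/\ x \in P, y \in P, z \in P & heron3 x y z <> 0].

Let D (i j : P) := sqd (val i) (val j).

Let DC (i j : P) : D i j = D j i. Proof. exact: sqdC. Qed.

Let P6 : (6 <= #|` P|)%N.
Proof. by apply: leq_trans P2d; rewrite -[6%N]/(2 * 3)%N leq_mul2l. Qed.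

Let T6 : (6 <= #|{: P}|)%N. Proof. by rewrite -cardfE. Qed.

(** For [d >= 3] the number [2d] exceeds [d + 2]. *)
Let too_big : ~ (#|{: P}| <= d + 2)%N.
Proof.
rewrite -cardfE => H; have := leq_trans P2d H.
by rewrite mul2n -addnn leq_add2l leqNgt d3.
Qed.

Let D_gt0 (i j : P) : i != j -> 0 < D i j.
Proof. by move=> /eqP ij; apply: sqd_gt0 => /val_inj. Qed.

Let third (i j : P) : exists k, k != i /\ k != j.
Proof.
have [k] : exists k, k \notin [:: i; j] by exact: exists_notin (leq_trans _ T6).
by rewrite !inE negb_or => /andP[]; exists k.
Qed.

(** No triangle has two sides [v] when [v] differs from [p], so these edges form a matching. The
    three cases are [v < 2p], excluded by [matching_bound]; [v > 2p], where a single pair is at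
    distance [v]; and [v = 2p], the orthoplex. *)
Lemma matching_types_orthoplex p v :
  all_triples D (fun a b c => perm3 a b c p p p \/ perm3 a b c p p v) ->
  regular_orthoplex P /\ (#|` P| <= 2 * d)%N.
Proof.
move=> types.
have HD i j : i != j -> D i j = p \/ D i j = v.
  move=> ij; have [k [ki kj]] := third i j.
  have := types i j k ij; rewrite eq_sym => /(_ kj ki).
  by case=> -[|[|[|[|[|]]]]] [] *; first [by left | by right].
have Hm i j k : i != j -> i != k -> D i j = v -> D i k = v -> v <> p -> j = k.
  move=> ij ik eij eik vp; apply: contrapT => /eqP jk.
  have := types i j k ij jk; rewrite eq_sym (DC k i) => /(_ ik).
  by case=> -[|[|[|[|[|]]]]] [] *; congruence.
have p0 : 0 < p.
  have [i _] : exists i : P, i \notin [::] by exact: exists_notin (leq_trans _ T6).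
  have [j [ij _]] := third i i; have [k [ki kj]] := third i j.
  have := types j i k ij; rewrite eq_sym => /(_ ki kj).
  have := D_gt0 ij; have := D_gt0 ki; rewrite DC => pki pij.
  by case=> -[|[|[|[|[|]]]]] [] *; congruence.
have [allp|] := pselect (forall i j, i != j -> D i j = p).
  case: too_big; apply: (@two_block_bound R _ d val set0 p p p p0 p0) => i j;
    rewrite ?inE //.
  by move=> _ _; apply: allp.
move=> /existsNP[a /existsNP[b /not_implyP[ab nab]]].
have eab : D a b = v by case: (HD a b ab).
have vp : v <> p by congruence.
have v0 : 0 < v by rewrite -eab D_gt0.
have [v2|v2|v2] := ltgtP v (2 * p).
- case: too_big; apply: (@matching_bound R _ d val p v) => //.
- case: too_big.
  (* For a second pair [i], [j] the squared length of [a + b - i - j] would be [4p - 2v], which is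
     negative. *)
  have only i j : i != j -> D i j = v -> i \in [set a; b].
    move=> ij eij; apply: contrapT; rewrite !inE => /negP; rewrite negb_or => /andP[ia ib].
    have ai : a != i by rewrite eq_sym.
    have bi : b != i by rewrite eq_sym.
    have ba : b != a by rewrite eq_sym.
    have ji : j != i by rewrite eq_sym.
    have aj : a != j.
      apply/eqP => aj; move/eqP: bi; apply; apply: (Hm a b i ab ai eab _ vp).
      by rewrite aj DC.
    have bj : b != j.
      apply/eqP => bj; move/eqP: ai; apply; apply: (Hm b a i ba bi _ _ vp).
        by rewrite DC.
      by rewrite bj DC.
    have e1 : D a i = p by case: (HD a i ai) => // e; case/eqP: bi; apply: (Hm a b i).
    have e2 : D a j = p by case: (HD a j aj) => // e; case/eqP: bj; apply: (Hm a b j).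
    have e3 : D b i = p.
      by case: (HD b i bi) => // e; case/eqP: ai; apply: (Hm b a i); rewrite // DC.
    have e4 : D b j = p.
      by case: (HD b j bj) => // e; case/eqP: aj; apply: (Hm b a j); rewrite // DC.
    have := dot_ge0 (val a + val b - val i - val j).
    have -> : dot (val a + val b - val i - val j) (val a + val b - val i - val j) =
        D a i + D a j + D b i + D b j - D a b - D i j.
      rewrite /D !sqdE !dotE ?(dotC (val b) (val a)) ?(dotC (val i) (val a))
        ?(dotC (val j) (val a)) ?(dotC (val i) (val b)) ?(dotC (val j) (val b))
        ?(dotC (val j) (val i)).
      by ring.
    by rewrite e1 e2 e3 e4 eab eij => ?; apply/negP: v2; rewrite -leNgt; lra.
  apply: (@two_block_bound R _ d val [set a; b] v p p v0 p0) => i j.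
  + by rewrite !inE => /orP[]/eqP-> /orP[]/eqP->; rewrite ?eqxx // -/(D _ _) => _ //; rewrite DC.
  + by move=> iA _ ij; case: (HD i j ij) => // e; move: iA; rewrite (only i j).
  + move=> iA jA; have ij : j != i by apply/eqP => e; rewrite e iA in jA.
    rewrite sqdC; case: (HD j i ij) => // e; move: jA; rewrite (only j i) //.
- apply: (@orthoplex_of_matching R d P p p0) => // [x y xP yP xy|x y z xP yP zP exy exz|].
  + have := HD (FSetSub xP) (FSetSub yP); rewrite -v2; apply.
    by apply/eqP => -[].
  + have H u : 0 < sqd x u -> forall (uP : u \in P), FSetSub xP != FSetSub uP.
      by move=> xu uP; apply/eqP => -[] e; move: xu; rewrite e sqdxx ltxx.
    rewrite -v2 in exy exz; have v0' := v0; rewrite -{1}exy in v0'.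
    have v0'' := v0; rewrite -{1}exz in v0''.
    have := Hm _ _ _ (H y v0' yP) (H z v0'' zP) exy exz vp.
    by move=> /(congr1 val).
  + by exists (val a), (val b); split; rewrite ?(valP a) ?(valP b) // -v2.
Qed.

(** Each triangle has one or three sides [p], so the points equal to [x] or at distance [p] from it
    form one block and the others a second; distances are [p] inside blocks and [u] across. *)
Lemma two_cliques_too_big p u : u <> p ->
  all_triples D (fun a b c => perm3 a b c p p p \/ perm3 a b c u u p) -> False.
Proof.
move=> up types.
have [x _] : exists x : P, x \notin [::] by exact: exists_notin (leq_trans _ T6).
have HD i j : i != j -> D i j = p \/ D i j = u.
  move=> ij; have [k [ki kj]] := third i j.
  have := types i j k ij; rewrite eq_sym => /(_ kj ki).
  by case=> -[|[|[|[|[|]]]]] [] *; first [by left | by right].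
have p0 : 0 < p.
  have [j [jx _]] := third x x; have [k [kx kj]] := third x j.
  have := types j x k jx; rewrite eq_sym => /(_ kx kj).
  have pj := D_gt0 jx; have pk := D_gt0 kx; rewrite DC in pk; have pkj := D_gt0 kj.
  by case=> -[|[|[|[|[|]]]]] [] *; congruence.
pose A := [set i | (i == x) || (D x i == p)].
apply: too_big; apply: (@two_block_bound R _ d val A p p u p0 p0) => i j.
- rewrite !inE -/(D i j) => /orP[/eqP->|/eqP xi] /orP[/eqP->|/eqP xj] ij //.
  + by rewrite eqxx in ij.
  + by rewrite DC.
  have [->//|ix] := eqVneq i x; have [->|jx] := eqVneq j x; first by rewrite DC.
  have := types x i j; rewrite eq_sym => /(_ ix ij jx); rewrite (DC j x).
  by case=> -[|[|[|[|[|]]]]] [] *; congruence.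
- rewrite !inE !negb_or -/(D i j) => /andP[ix /eqP xi] /andP[jx /eqP xj] ij.
  have := types x i j; rewrite eq_sym => /(_ ix ij jx); rewrite (DC j x).
  by case=> -[|[|[|[|[|]]]]] [] *; congruence.
- rewrite !inE !negb_or -/(D i j) => iA /andP[jx /eqP xj].
  have xju : D x j = u by case: (HD x j) => //; rewrite eq_sym.
  have [->//|ix] := eqVneq i x.
  move: iA; rewrite (negPf ix) /= => /eqP xi.
  have ij : i != j by apply/eqP => e; congruence.
  have := types x i j; rewrite eq_sym => /(_ ix ij jx); rewrite (DC j x).
  by case=> -[|[|[|[|[|]]]]] [] *; congruence.
Qed.

Lemma two_types_orthoplex : regular_orthoplex P /\ (#|` P| <= 2 * d)%N.
Proof.
have types : all_triples D
    (fun a b c => perm3 a b c x1 y1 z1 \/ perm3 a b c x2 y2 z2).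
  move=> i j k /eqP ij /eqP jk /eqP ki.
  apply: two_types; rewrite ?(valP i) ?(valP j) ?(valP k) //.
  by apply: (no_collinear two_types has_triangle P6) (valP i) (valP j) (valP k) _ _ _ =>
    /val_inj.
have [p [[v t]|[u up t]]] := two_type_coloring DC T6 types.
  exact: matching_types_orthoplex t.
by case: (two_cliques_too_big up t).
Qed.
End TwoTypes.

(** * Congruence classes and side lengths *)

Section Classes.
Variables (R : realType) (d : nat).
Implicit Types (x y z : 'rV[R]_d) (S T P : {fset 'rV[R]_d}).

Lemma heron3_neq0_uniq x y z : heron3 x y z <> 0 -> [/\ x <> y, y <> z & z <> x].
Proof.
move=> H; split=> e; apply: H; rewrite e /heron3 sqdxx /heron;
  [rewrite (sqdC z y)|rewrite (sqdC z x)|rewrite (sqdC y x)]; ring.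
Qed.

(** Passes from three-element sets to ordered triples, for which types are computed. *)
Lemma trianglesP P T : reflect (exists x y z,
    [/\ x \in P, y \in P, z \in P, heron3 x y z <> 0 & T = [fset x; y; z]])
  (T \in triangles P).
Proof.
apply: (iffP idP).
  rewrite !inE /= fpowersetE => /andP[/fsubsetP TP /andP[/eqP T3 /asboolPn nc]].
  move: T3 (fset_uniq T); case E : (enum_fset T) => [|x [|y [|z [|? ?]]]] //= _.
  rewrite !inE !negb_or andbT => /andP[/andP[xy xz] yz].
  have TE : T = [fset x; y; z].
    by apply/fsetP => w; rewrite !inE -[w \in T]/(w \in enum_fset T) E !inE orbA.
  exists x, y, z; split=> //; try by apply: TP; rewrite TE !inE eqxx ?orbT.
  by move=> h; apply: nc; rewrite TE; apply/collinear3P => //; apply/eqP.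
move=> [x [y [z [xP yP zP h ->]]]]; have [xy yz zx] := heron3_neq0_uniq h.
rewrite !inE /= fpowersetE; apply/and3P; split.
- by apply/fsubsetP => w; rewrite !inE -orbA => /or3P[]/eqP->.
- have /eqP/negPf xy' := xy; have /eqP/negPf yz' := yz; have /eqP/negPf zx' := zx.
  by rewrite fsetUC cardfsU1 cardfs2 !inE xy' zx' (eq_sym z y) yz'.
- by apply/asboolPn => /(collinear3P _ xy).
Qed.

Lemma congruent_refl S : congruent S S.
Proof. by exists id => //; apply: imfset_id. Qed.

Lemma perm3_fset x y z x' y' z' :
  perm3 x y z x' y' z' -> [fset x; y; z] = [fset x'; y'; z'].
Proof.
by move=> H; apply/fsetP => w; case: H => [|[|[|[|[|]]]]] [-> -> ->]; rewrite !inE;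
  do 3?case: (w == _).
Qed.

(** Any permutation of the sides comes from relabelling the vertices of the second triangle, after
    which [congruent_sss] applies. *)
Lemma congruent_triangleP x y z x' y' z' : heron3 x y z <> 0 ->
  congruent [fset x; y; z] [fset x'; y'; z'] <->
  perm3 (sqd x y) (sqd y z) (sqd z x) (sqd x' y') (sqd y' z') (sqd z' x').
Proof.
move=> h; have [xy yz zx] := heron3_neq0_uniq h; split.
  exact: congruent_perm3.
have via a b c : perm3 x' y' z' a b c ->
    sqd x y = sqd a b -> sqd y z = sqd b c -> sqd z x = sqd c a ->
    congruent [fset x; y; z] [fset x'; y'; z'].
  by move=> /perm3_fset -> *; apply: congruent_sss.
case=> [|[|[|[|[|]]]]] [e1 e2 e3].
- by apply: (via x' y' z') => //; left.
- by apply: (via y' x' z'); rewrite 1?[RHS]sqdC //; do 5?[by left | right].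
- by apply: (via z' y' x'); rewrite 1?[RHS]sqdC //; do 5?[by left | right].
- by apply: (via y' z' x') => //; do 5?[by left | right].
- by apply: (via z' x' y') => //; do 5?[by left | right].
- by apply: (via x' z' y'); rewrite 1?[RHS]sqdC //; do 5?[by left | right].
Qed.

Definition triangle_class P S := [fset T in triangles P | `[< congruent S T >]].

Lemma in_triangle_class P S T :
  (T \in triangle_class P S) = (T \in triangles P) && `[< congruent S T >].
Proof. by rewrite /triangle_class; move: (triangles P) => Q; rewrite !inE. Qed.

(** The types are the squared sides of one representative of each class; a triangle lies in its own
    class, which is one of the two. *)
Lemma two_classes_two_types P : num_triangles P = 2%N ->
  exists x1 y1 z1 x2 y2 z2 : R,
    (forall x y z, x \in P -> y \in P -> z \in P -> heron3 x y z <> 0 ->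
      perm3 (sqd x y) (sqd y z) (sqd z x) x1 y1 z1 \/
      perm3 (sqd x y) (sqd y z) (sqd z x) x2 y2 z2) /\
    (exists x y z, [/\ x \in P, y \in P, z \in P & heron3 x y z <> 0]).
Proof.
rewrite /num_triangles.
case E : (enum_fset (triangle_classes P)) => [|C1 [|C2 [|? ?]]] //= _.
have memC C : (C \in triangle_classes P) = (C == C1) || (C == C2).
  by rewrite -[LHS]/(C \in enum_fset (triangle_classes P)) E !inE.
have /imfsetP[S1 /= S1P C1E] : C1 \in triangle_classes P by rewrite memC eqxx.
have /imfsetP[S2 /= S2P C2E] : C2 \in triangle_classes P by rewrite memC eqxx orbT.
have /trianglesP[a1 [b1 [c1 [a1P b1P c1P h1 S1E]]]] := S1P.
have /trianglesP[a2 [b2 [c2 [_ _ _ h2 S2E]]]] := S2P.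
exists (sqd a1 b1), (sqd b1 c1), (sqd c1 a1), (sqd a2 b2), (sqd b2 c2), (sqd c2 a2).
split; last by exists a1, b1, c1.
move=> x y z xP yP zP h.
pose T := [fset x; y; z].
have TP : T \in triangles P by apply/trianglesP; exists x, y, z.
have TT : T \in triangle_class P T.
  by rewrite in_triangle_class TP; apply/asboolP; apply: congruent_refl.
have : triangle_class P T \in triangle_classes P.
  by apply/imfsetP; exists T.
rewrite memC => /orP[]/eqP CE; rewrite CE ?C1E ?C2E -/(triangle_class P _) in TT; move: TT;
  rewrite in_triangle_class => /andP[_ /asboolP]; [rewrite S1E; left|rewrite S2E; right].
- by have [? ? ?] := heron3_neq0_uniq h1; apply: perm3_sym; apply: congruent_perm3.
- by have [? ? ?] := heron3_neq0_uniq h2; apply: perm3_sym; apply: congruent_perm3.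
Qed.

Lemma two_types_num_triangles P (p v : R) : p <> v ->
  (forall x y z, x \in P -> y \in P -> z \in P -> heron3 x y z <> 0 ->
    perm3 (sqd x y) (sqd y z) (sqd z x) p p p \/
    perm3 (sqd x y) (sqd y z) (sqd z x) p p v) ->
  (exists x y z, [/\ x \in P, y \in P, z \in P, heron3 x y z <> 0 &
    perm3 (sqd x y) (sqd y z) (sqd z x) p p p]) ->
  (exists x y z, [/\ x \in P, y \in P, z \in P, heron3 x y z <> 0 &
    perm3 (sqd x y) (sqd y z) (sqd z x) p p v]) ->
  num_triangles P = 2%N.
Proof.
move=> pv types [a1 [b1 [c1 [a1P b1P c1P h1 t1]]]] [a2 [b2 [c2 [a2P b2P c2P h2 t2]]]].
pose cls := triangle_class P.
have perm_cls x y z x' y' z' : heron3 x y z <> 0 -> heron3 x' y' z' <> 0 ->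
    perm3 (sqd x y) (sqd y z) (sqd z x) (sqd x' y') (sqd y' z') (sqd z' x') ->
    cls [fset x; y; z] = cls [fset x'; y'; z'].
  move=> h h' H; apply/fsetP => T.
  rewrite /cls (in_triangle_class P _ T) [RHS](in_triangle_class P _ T).
  case: (boolP (T \in triangles P)) => //= /trianglesP[a [b [c [_ _ _ _ ->]]]].
  apply/asboolP/asboolP => /congruent_triangleP C; apply/congruent_triangleP => //.
    by apply: perm3_trans (perm3_sym H) _; apply: C.
  by apply: perm3_trans H _; apply: C.
pose T1 := [fset a1; b1; c1]; pose T2 := [fset a2; b2; c2].
have T1P : T1 \in triangles P by apply/trianglesP; exists a1, b1, c1.
have T2P : T2 \in triangles P by apply/trianglesP; exists a2, b2, c2.
have -> : num_triangles P = #|` [fset cls T1; cls T2]|.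
  congr (#|` _|); apply/fsetP => C; rewrite !inE; apply/imfsetP/orP => /= [[S]|].
    move=> /trianglesP[x [y [z [xP yP zP h ->]]]] ->.
    by have [t|t] := types x y z xP yP zP h; [left|right]; apply/eqP/perm_cls => //;
      apply: perm3_trans t (perm3_sym _).
  by case=> /eqP->; [exists T1|exists T2].
rewrite cardfs2; case: eqP => //= e.
have : T2 \in cls T1.
  by rewrite e in_triangle_class T2P; apply/asboolP; apply: congruent_refl.
rewrite in_triangle_class => /andP[_ /asboolP/(congruent_triangleP _ _ _ h1) H].
by case: (perm3_trans (perm3_sym t1) (perm3_trans H t2)) => [|[|[|[|[|]]]]] [] *;
  congruence.
Qed.

(** Three vertices lie on three different axes and form an equilateral triangle, or two of them are
    antipodal and the third is on another axis. *)
Lemma orthoplex_num_triangles P : (3 <= d)%N -> regular_orthoplex P ->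
  num_triangles P = 2%N.
Proof.
move=> d3 [f [r r0 fr] ->].
have fd x y : sqd (f x) (f y) = r ^+ 2 * sqd x y.
  by rewrite -!sqr_edist fr exprMn.
have q0 : 0 < r ^+ 2 by rewrite exprn_gt0.
pose e (b : bool) (i : 'I_d) : 'rV[R]_d := (-1) ^+ b *: delta_mx 0 i.
have dot_delta (i j : 'I_d) : dot (delta_mx 0 i) (delta_mx 0 j) = (i == j)%:R :> R.
  rewrite /dot (bigD1 i) //= big1 => [|k ki].
    by rewrite !mxE !eqxx mul1r addr0.
  by rewrite !mxE eqxx (negPf ki) mul0r.
have edist2 a b (i j : 'I_d) : sqd (e a i) (e b j) =
    2 - 2 * ((-1) ^+ a * (-1) ^+ b * (i == j)%:R).
  by rewrite sqdE /e !dotE !dot_delta !eqxx /=; case: a; case: b => /=; ring.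
have mem b i : f (e b i) \in [fset f x | x in std_orthoplex R d].
  apply/imfsetP; exists (e b i) => //=; rewrite in_fsetU; apply/orP.
  by case: b; [right|left]; apply/imfsetP; exists i => //; rewrite /e ?expr1 ?scaleN1r ?expr0 ?scale1r.
have memP y : y \in [fset f x | x in std_orthoplex R d] -> exists b i, y = f (e b i).
  move=> /imfsetP[x /= + ->]; rewrite in_fsetU => /orP[]/imfsetP[i _ ->].
    by exists false, i; rewrite /e expr0 scale1r.
  by exists true, i; rewrite /e expr1 scaleN1r.
pose p := r ^+ 2 * 2; pose v := r ^+ 2 * 4.
have fE a b (i j : 'I_d) : sqd (f (e a i)) (f (e b j)) =
    if i == j then if a == b then 0 else v else p.
  rewrite fd edist2; case: (i == j); last by rewrite /p /=; ring.
  by case: a; case: b; rewrite /v /=; ring.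
apply: (@two_types_num_triangles _ p v).
- by rewrite /p /v => H; move: q0; rewrite (_ : r ^+ 2 = 0) ?ltxx //; lra.
- move=> x y z /memP[a [i ->]] /memP[b [j ->]] /memP[c [k ->]].
  move=> /heron3_neq0_uniq[xy yz zx]; rewrite !fE.
  have [ij|ij] := eqVneq i j.
    (* An axis carries only two vertices, so the third point is on another one. *)
    subst j; have ki : k != i.
      by apply/eqP => ki; subst k; case: a b c xy yz zx => [] [] [].
    rewrite (negPf ki) (eq_sym i k) (negPf ki); case: eqP => [ab|_].
      by case: xy; rewrite ab.
    by right; do 5?[by left | right].
  have [jk|jk] := eqVneq j k.
    subst k; rewrite (eq_sym j i) (negPf ij); case: eqP => [bc|_].
      by case: yz; rewrite bc.
    by right; do 5?[by left | right].
  have [ki|ki] := eqVneq k i; last by left; left.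
  case: eqP => [ca|_]; first by case: zx; rewrite ca ki.
  by right; do 5?[by left | right].
- pose i0 : 'I_d := Ordinal (leq_trans (isT : 0 < 3)%N d3).
  pose i1 : 'I_d := Ordinal (leq_trans (isT : 1 < 3)%N d3).
  pose i2 : 'I_d := Ordinal (leq_trans (isT : 2 < 3)%N d3).
  exists (f (e false i0)), (f (e false i1)), (f (e false i2)).
  split; rewrite ?mem // /heron3 !fE /=; last by left.
  rewrite /heron /p => H; have : (r ^+ 2) ^+ 2 = 0 by lra.
  by move/eqP; rewrite sqrf_eq0 gt_eqF.
- pose i0 : 'I_d := Ordinal (leq_trans (isT : 0 < 3)%N d3).
  pose i1 : 'I_d := Ordinal (leq_trans (isT : 1 < 3)%N d3).
  exists (f (e false i0)), (f (e true i0)), (f (e false i1)).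
  split; rewrite ?mem // /heron3 !fE /=; last by do 5?[by left | right].
  rewrite /heron /p /v => H; have : (r ^+ 2) ^+ 2 = 0 by lra.
  by move/eqP; rewrite sqrf_eq0 gt_eqF.
Qed.
End Classes.


(* The bound and its equality case *)
Local Close Scope ring_scope.

Theorem theorem1 (R : realType) (d : nat) (hd : 3 <= d) :
  (forall P : {fset 'rV[R]_d}, num_triangles P = 2 -> #|` P| <= 2 * d)
  /\ (forall P : {fset 'rV[R]_d}, #|` P| = 2 * d ->
        (num_triangles P = 2 <-> regular_orthoplex P)).
Proof.
(* Sets of fewer than [2d] points satisfy the bound at once, so both claims reduce to sets with at
   least [2d] points. *)
have core (P : {fset 'rV[R]_d}) : num_triangles P = 2%N -> (2 * d <= #|` P|)%N ->
    regular_orthoplex P /\ (#|` P| <= 2 * d)%N.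
  move=> /two_classes_two_types[x1 [y1 [z1 [x2 [y2 [z2 [types tri]]]]]]] P2d.
  exact: two_types_orthoplex hd P2d types tri.
split=> P.
  by move=> /core H; have [/H[]|/ltnW] := leqP (2 * d) #|` P|.
move=> Pd; split=> [/core[]//|]; first by rewrite Pd.
exact: orthoplex_num_triangles.
Qed.
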